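(* Let $\psi = \varphi_w$ with $w \in \{a,b,\alpha,\beta\}^*$. If at least three distinct letters of $\{a,b,\alpha,\beta\}$ occur in $w$, then $\psi$ is not closeable under derivation.
   Context: Morphisms on $\{0,1\}^*$: $\varphi_a: 0\mapsto 0, 1 \mapsto 10$; $\varphi_b: 0 \mapsto 0, 1\mapsto 01$; $\varphi_\alpha: 0\mapsto 01, 1\mapsto 1$; $\varphi_\beta: 0\mapsto 10, 1 \mapsto 1$; for $w=w_0\cdots w_{m-1}$, $\varphi_w = \varphi_{w_0}\circ\cdots\circ\varphi_{w_{m-1}}$ (this is primitive iff $w$ contains a letter from $\{a,b\}$ and one from $\{\alpha,\beta\}$). A morphism $\psi$ is primitive if some power $\psi^k$ has every letter occurring in every $\psi^k(c)$. A substitution is a morphism $\psi$ with a letter $c$ such that $\psi(c) = cx$ for a nonempty word $x$ and $|\psi^n(c)|\to\infty$. Derived word: for a uniformly recurrent word $\mathbf{u}$ and a factor $v$, a return word of $v$ is a factor $r$ such that $rv$ is a factor in which $v$ occurs exactly twice (as prefix and as suffix); if $r_0,\dots,r_k$ are all return words, write $\mathbf{u} = p\,r_{s_0}r_{s_1}\cdots$ with $|p|$ the first occurrence of $v$; then $\mathbf{d}_{\mathbf{u}}(v) = s_0s_1s_2\cdots$, considered up to permutation of letters. A finite set $M$ of primitive substitutions is closed under derivation if for every $\varphi\in M$, every fixed point $\mathbf{u}$ of $\varphi$ and every factor $v$ of $\mathbf{u}$, the derived word $\mathbf{d}_{\mathbf{u}}(v)$ is fixed by some primitive substitution $\psi \in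 M$. A primitive substitution is closeable under derivation if it belongs to some finite set closed under derivation. *)

(* Defs.v *)
From HB Require Import structures.
From mathcomp Require Import all_boot.
Set Implicit Arguments. Unset Strict Implicit. Unset Printing Implicit Defensive.

Definition morph (k : nat) := {ffun 'I_k -> seq 'I_k}.

Definition mapply k (f : morph k) (s : seq 'I_k) : seq 'I_k := flatten (map f s).

Definition mpow k (f : morph k) (n : nat) (s : seq 'I_k) : seq 'I_k :=
  iter n (mapply f) s.

Definition primitive k (f : morph k) : Prop :=
  exists n, 0 < n /\ forall c d : 'I_k, d \in mpow f n [:: c].

Definition substitution k (f : morph k) : Prop :=
  exists c : 'I_k,
    (exists x : seq 'I_k, x != [::] /\ f c = c :: x) /\
    (forall m, exists n, m <= size (mpow f n [:: c])).

Definition prefix (A : Type) (u : nat -> A) (n : nat) : seq A := map u (iota 0 n).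

(** u is a fixed point of f: psi(u) = u, where psi(u) is the infinite word whose
    prefixes are the images of the prefixes of u. *)
Definition fixed_point k (f : morph k) (u : nat -> 'I_k) : Prop :=
  (forall n, mapply f (prefix u n) = prefix u (size (mapply f (prefix u n)))) /\
  (forall m, exists n, m <= size (mapply f (prefix u n))).

Definition occurs_at (A : eqType) (u : nat -> A) (v : seq A) (n : nat) : Prop :=
  forall j, j < size v -> u (n + j) = nth (u 0) v j.

Definition factor (A : eqType) (u : nat -> A) (v : seq A) : Prop :=
  exists n, occurs_at u v n.

Definition occ_enum (A : eqType) (u : nat -> A) (v : seq A) (p : nat -> nat) : Prop :=
  (forall i, p i < p i.+1) /\ (forall n, occurs_at u v n <-> exists i, p i = n).

(** The i-th return word in the decomposition u = pref r_{s_0} r_{s_1} ... :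
    the factor of u between the i-th and (i+1)-th occurrences of v. The derived
    word d_u(v) is the sequence i |-> (return word i), up to renaming letters. *)
Definition return_word (A : Type) (u : nat -> A) (p : nat -> nat) (i : nat) : seq A :=
  map u (iota (p i) (p i.+1 - p i)).

Definition any_morph := {k : nat & morph k}.

Definition pack_morph k (f : morph k) : any_morph := Tagged morph f.

(** A finite set M of primitive substitutions closed under derivation: for every
    psi in M, every fixed point u of psi and every factor v of u, the derived word
    d_u(v) is (up to a bijective renaming of letters) fixed by some psi' in M. *)
Definition closed_under_derivation (M : seq any_morph) : Prop :=
  (forall k (f : morph k), pack_morph f \in M -> primitive f /\ substitution f) /\
  (forall k (f : morph k), pack_morph f \in M ->
     forall u : nat -> 'I_k, fixed_point f u ->
     forall v : seq 'I_k, factor u v ->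
     forall p, occ_enum u v p ->
     exists k' (g : morph k'), pack_morph g \in M /\
       exists x : nat -> 'I_k', fixed_point g x /\
         forall i j, return_word u p i = return_word u p j <-> x i = x j).

Definition closeable k (f : morph k) : Prop :=
  exists M : seq any_morph, pack_morph f \in M /\ closed_under_derivation M.

Inductive letter := La | Lb | Lalpha | Lbeta.

Definition letter_eqb (x y : letter) : bool :=
  match x, y with
  | La, La | Lb, Lb | Lalpha, Lalpha | Lbeta, Lbeta => true
  | _, _ => false end.

Lemma letter_eqP : Equality.axiom letter_eqb.
Proof. by case; case; constructor. Qed.

HB.instance Definition _ := hasDecEq.Build letter letter_eqP.

Definition b0 : 'I_2 := @Ordinal 2 0 isT.
Definition b1 : 'I_2 := @Ordinal 2 1 isT.

Definition phi_letter (l : letter) : morph 2 :=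
  [ffun c : 'I_2 =>
     match l with
     | La => if val c == 0 then [:: b0] else [:: b1; b0]
     | Lb => if val c == 0 then [:: b0] else [:: b0; b1]
     | Lalpha => if val c == 0 then [:: b0; b1] else [:: b1]
     | Lbeta => if val c == 0 then [:: b1; b0] else [:: b1]
     end].

Definition phi_w (w : seq letter) : morph 2 :=
  [ffun c : 'I_2 => foldr (fun l s => mapply (phi_letter l) s) [:: c] w].

(* Main.v *)
Require Import Defs.
From mathcomp Require Import all_boot all_order all_algebra zify ring.
Set Implicit Arguments. Unset Strict Implicit. Unset Printing Implicit Defensive.
Import Order.TTheory GRing.Theory Num.Theory.

(** Replace a by b and alpha by beta in w: the resulting standard morphism F is a
    conjugate of phi_w, F(s) sigma = sigma phi_w(s), so a fixed point u of phi_w satisfies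
    F(u) = sigma u.  The bispecial factor B attached to F occurs in F(u) exactly at the
    positions |F(u_m)|, where u_m is the prefix of length m of u; hence the derived word
    of u with respect to B is x = S^j u, where S is the shift and j is minimal with
    |F(u_j)| >= |sigma|, and F(x) = S^q x for some q.  If w contains three letters and is
    replaced by a large power, then q > 0.

    Suppose that x is also fixed by a morphism h with |h(c)| >= 2.  Let r be the longest
    common suffix of h(01) and h(10); there is a conjugate G of h with G(s) r = r h(s),
    so G(x) = r x.  Both F and G map prefixes of the characteristic word (the limit of the
    bispecial factors) to such prefixes.  Balance and the irrationality of the slope show
    that the incidence matrices commute, and then FG = GF.  Comparing the positions in x
    of both sides of FG(x) = GF(x) gives |G(x_q)| + |F(r)| = q + |r|, which is impossible
    since |G(x_q)| >= 2q and |F(r)| >= |r|. *)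

Local Notation pre := Defs.prefix.

(** * Infinite words: prefixes and shifts *)

Definition shift (T : Type) (q : nat) (x : nat -> T) : nat -> T := fun i => x (q + i).

Lemma size_pre (T : Type) (x : nat -> T) n : size (pre x n) = n.
Proof. by rewrite size_map size_iota. Qed.

Lemma preD (T : Type) (x : nat -> T) m n : pre x (m + n) = pre x m ++ pre (shift m x) n.
Proof. by rewrite /pre iotaD map_cat add0n (_ : iota m n = map (addn m) (iota 0 n)) -?map_comp // -iotaDl addn0. Qed.

Lemma preS (T : Type) (x : nat -> T) n : pre x n.+1 = pre x n ++ [:: x n].
Proof. by rewrite -addn1 preD /pre /= /shift addn0. Qed.

Lemma nth_pre (T : Type) (d : T) (x : nat -> T) n i : i < n -> nth d (pre x n) i = x i.
Proof. by move=> Hi; rewrite (nth_map 0) ?size_iota // nth_iota. Qed.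

Lemma eq_pre (T : Type) (x y : nat -> T) n : x =1 y -> pre x n = pre y n.
Proof. by move=> H; apply: eq_map. Qed.

Lemma pre_inj (T : Type) (x y : nat -> T) n i : pre x n = pre y n -> i < n -> x i = y i.
Proof. by move=> E Hi; rewrite -(nth_pre (x 0) x Hi) E nth_pre. Qed.

Lemma catl_inj (T : Type) (s s' t t' : seq T) :
  s ++ t = s' ++ t' -> size s = size s' -> s = s' /\ t = t'.
Proof.
move=> E Hs; split.
  by rewrite -(take_size_cat t (erefl (size s))) E Hs take_size_cat.
by rewrite -(drop_size_cat t (erefl (size s))) E Hs drop_size_cat.
Qed.

(** * Morphisms on finite and infinite words *)

Definition ext (T U : Type) (h : T -> seq U) (s : seq T) : seq U := flatten (map h s).

Definition nonerasing (T U : Type) (h : T -> seq U) := forall c, 0 < size (h c).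

Lemma ext_cat (T U : Type) (h : T -> seq U) s t : ext h (s ++ t) = ext h s ++ ext h t.
Proof. by rewrite /ext map_cat flatten_cat. Qed.

Lemma ext_cons (T U : Type) (h : T -> seq U) c s : ext h (c :: s) = h c ++ ext h s.
Proof. by []. Qed.

Lemma ext_seq1 (T U : Type) (h : T -> seq U) c : ext h [:: c] = h c.
Proof. by rewrite /ext /= cats0. Qed.

Lemma size_ext_ge (T U : Type) (h : T -> seq U) s : nonerasing h -> size s <= size (ext h s).
Proof.
move=> Hh; elim: s => //= c s IH.
by rewrite ext_cons size_cat; have := Hh c; lia.
Qed.

Definition isimg (T : Type) (h : T -> seq T) (x y : nat -> T) :=
  forall n, ext h (pre x n) = pre y (size (ext h (pre x n))).

(** For nonerasing [h] the image of i+1 letters has more than i letters, so the default [x 0] is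
    never reached. *)
Definition limg (T : Type) (h : T -> seq T) (x : nat -> T) : nat -> T :=
  fun i => nth (x 0) (ext h (pre x i.+1)) i.

Lemma limgP (T : Type) (h : T -> seq T) x : nonerasing h -> isimg h x (limg h x).
Proof.
move=> Hh n; apply: (@eq_from_nth _ (x 0)); first by rewrite size_pre.
move=> i Hi; rewrite nth_pre // /limg.
have Hi' : i < size (ext h (pre x i.+1)).
  by apply: leq_trans (size_ext_ge _ Hh); rewrite size_pre.
case: (leqP n i.+1) => H.
  by rewrite -[in RHS](subnKC H) preD ext_cat nth_cat Hi.
by rewrite -[in LHS](subnKC (ltnW H)) preD ext_cat nth_cat Hi'.
Qed.

Lemma isimg_shift (T : Type) (h : T -> seq T) x y m : isimg h x y ->
  isimg h (shift m x) (shift (size (ext h (pre x m))) y).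
Proof.
move=> H n; have := H (m + n).
rewrite preD ext_cat size_cat preD => E.
by case: (catl_inj E) => //; rewrite size_pre.
Qed.

(** * Occurrences of finite words *)

Definition occ (T : Type) (x : nat -> T) (v : seq T) (n : nat) :=
  pre (shift n x) (size v) = v.

Lemma occ_cat (T : Type) (x : nat -> T) v w n :
  occ x (v ++ w) n <-> occ x v n /\ occ x w (n + size v).
Proof.
have E : shift (size v) (shift n x) =1 shift (n + size v) x.
  by move=> i; rewrite /shift addnA.
rewrite /occ size_cat preD (eq_pre _ E); split.
  by move=> H; apply: (catl_inj H); rewrite size_pre.
by case=> -> ->.
Qed.

Lemma occ_cons (T : Type) (x : nat -> T) a v n :
  occ x (a :: v) n <-> x n = a /\ occ x v n.+1.
Proof.
rewrite -cat1s occ_cat /= addn1; suff -> : occ x [:: a] n <-> x n = a by [].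
by rewrite /occ /= /shift /pre /= addn0; split=> [[]|->].
Qed.

Lemma occurs_atP (T : eqType) (x : nat -> T) v n : occurs_at x v n <-> occ x v n.
Proof.
split=> [H | H j Hj]; last by rewrite -[in RHS]H nth_pre.
apply: (@eq_from_nth _ (x 0)); first by rewrite size_pre.
by rewrite size_pre => i Hi; rewrite nth_pre // -H.
Qed.

Lemma eq_occ (T : Type) (x y : nat -> T) v n m :
  (forall i, x (n + i) = y (m + i)) -> occ x v n <-> occ y v m.
Proof. by move=> E; rewrite /occ (@eq_pre _ (shift n x) (shift m y)). Qed.

Lemma occ_pre (T : Type) (x : nat -> T) m n : occ x (pre (shift m x) n) m.
Proof. by rewrite /occ size_pre. Qed.

Lemma isimg_occ (T : Type) (h : T -> seq T) x y v n : isimg h x y ->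
  occ x v n -> occ y (ext h v) (size (ext h (pre x n))).
Proof. by move=> H E; have := isimg_shift n H (size v); rewrite E. Qed.

(** * Desubstitution of one elementary standard morphism *)

(* Over {0,1}: tau 0 = phi_b and tau 1 = phi_beta. *)
Definition tau (T : eqType) (e c : T) : seq T := if c == e then [:: e] else [:: e; c].

Local Notation std e := (ext (tau e)).

Lemma tau_nonerasing (T : eqType) (e : T) : nonerasing (tau e).
Proof. by rewrite /tau => c; case: ifP. Qed.

Lemma std_head (T : eqType) (e : T) v : exists t, std e v ++ [:: e] = e :: t.
Proof.
case: v => [|c v]; first by exists [::].
by rewrite ext_cons /tau; case: ifP => _; eexists.
Qed.

Lemma size_std_preS (T : eqType) (e : T) x m :
  size (std e (pre x m.+1)) = size (std e (pre x m)) + (x m != e).+1.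
Proof. by rewrite preS ext_cat ext_seq1 size_cat /tau; case: eqP. Qed.

Lemma std_block (T : eqType) (e : T) x y m : isimg (tau e) x y ->
  occ y (tau e (x m)) (size (std e (pre x m))).
Proof.
move=> H; rewrite -ext_seq1; apply: (isimg_occ H).
by rewrite /occ /= /pre /= /shift addn0.
Qed.

Lemma std_boundary (T : eqType) (e : T) x y m : isimg (tau e) x y ->
  y (size (std e (pre x m))) = e.
Proof. by move/(std_block m); rewrite /tau; case: eqP => _ /occ_cons []. Qed.

Lemma std_inner (T : eqType) (e : T) x y m : isimg (tau e) x y -> x m != e ->
  y (size (std e (pre x m))).+1 = x m.
Proof.
by move/(std_block m) => H /negbTE E; move: H; rewrite /tau E => /occ_cons [_ /occ_cons []].
Qed.

Lemma std_position (T : eqType) (e : T) x n :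
  exists m, n = size (std e (pre x m)) \/ x m != e /\ n = (size (std e (pre x m))).+1.
Proof.
elim: n => [|n [m [->|[Hm ->]]]]; first by exists 0; left.
  case: (eqVneq (x m) e) => E; last by exists m; right.
  by exists m.+1; left; rewrite size_std_preS E eqxx /=; lia.
by exists m.+1; left; rewrite size_std_preS Hm /=; lia.
Qed.

(** A letter other than [e] is the second letter of a block, so it stands between the [e] that opens
    its block and the [e] that opens the next one. *)
Lemma std_non_e (T : eqType) (e : T) x y n : isimg (tau e) x y -> y n != e ->
  y n.+1 = e /\ 0 < n /\ y n.-1 = e.
Proof.
move=> H; case: (std_position e x n) => m [->|[Hm ->]]; first by rewrite (std_boundary m H) eqxx.
rewrite (std_boundary m H) /=; move=> _.
have -> : (size (std e (pre x m))).+2 = size (std e (pre x m.+1)).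
  by rewrite size_std_preS Hm /=; lia.
by rewrite (std_boundary _ H).
Qed.

(** Blocks are decoded from left to right. The final [e] gives one letter of look-ahead: after an
    [e], another [e] means that the block was [e] alone, and any other letter completes the
    block. *)
Lemma std_decode (T : eqType) (e : T) x y v m : isimg (tau e) x y ->
  occ y (std e v ++ [:: e]) (size (std e (pre x m))) -> occ x v m.
Proof.
move=> H; elim: v m => [|c v IH] m; first by [].
rewrite ext_cons -catA {1}/tau.
case: (eqVneq c e) => [->|Hc] /=.
  move=> /occ_cons [_ Ho]; have [t Et] := std_head e v.
  have : y (size (std e (pre x m))).+1 = e by move: Ho; rewrite Et => /occ_cons [].
  case: (eqVneq (x m) e) => [Exm _|Hm]; last by rewrite std_inner // => /eqP; rewrite (negbTE Hm).
  apply/occ_cons; split=> //; apply: IH.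
  by rewrite size_std_preS Exm eqxx /= addn1.
move=> /occ_cons [_ /occ_cons [E Ho]].
case: (eqVneq (x m) e) => [Exm|Hm].
  have := std_boundary m.+1 H; rewrite size_std_preS Exm eqxx addn1 E => /eqP.
  by rewrite (negbTE Hc).
apply/occ_cons; split; first by rewrite -E std_inner.
by apply: IH; rewrite size_std_preS Hm addn2.
Qed.

(** The second letter of a long block is never [e], so a factor with first letter [e] starts at a
    block boundary. *)
Lemma std_occ (T : eqType) (e : T) x y v n : isimg (tau e) x y ->
  occ y (std e v ++ [:: e]) n <-> exists m, n = size (std e (pre x m)) /\ occ x v m.
Proof.
move=> H; split.
  move=> Ho; have [t Et] := std_head e v.
  have En : y n = e by move: Ho; rewrite Et => /occ_cons [].
  case: (std_position e x n) => m [E|[Hm E]]; last first.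
    by move: En; rewrite E std_inner // => /eqP; rewrite (negbTE Hm).
  by exists m; split=> //; apply: (std_decode H); rewrite -E.
case=> m [-> Ho]; apply/occ_cat; split; first exact: isimg_occ.
apply/occ_cons; split=> //.
have <- : size (std e (pre x (m + size v))) = size (std e (pre x m)) + size (std e v).
  by rewrite preD Ho ext_cat size_cat.
exact: std_boundary.
Qed.

(** Since [tau e c] ends in [c], the letter just before a block boundary is the preceding letter of
    [x]. *)
Lemma std_factor_decode (T : eqType) (e : T) x y a v n : isimg (tau e) x y ->
  occ y (a :: std e v ++ [:: e]) n -> exists m, occ x (a :: v) m.
Proof.
move=> H /occ_cons [Ea /(std_occ _ _ H) [[|m] [En Ho]]]; first by [].
exists m; apply/occ_cons; split=> //.
move: En; rewrite size_std_preS; case: (eqVneq (x m) e) => [Exm|Hm].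
  by rewrite addn1 => -[En]; rewrite Exm -(std_boundary m H) -En.
by rewrite addn2 => -[En]; rewrite -(std_inner H Hm) -En.
Qed.

(** If a nonempty prefix of an image ends in [e], removing this [e] leaves complete blocks; if it
    ends in another letter, it already consists of complete blocks. *)
Lemma std_parse (T : eqType) (e : T) s v t : std e s = v ++ t -> v = [::] \/
  exists v1, size v1 < size v /\
    (v = std e v1 ++ [:: e] \/ v = std e v1 /\ last e v != e).
Proof.
elim: s v => [|c s IH] v; first by case: v => //; left.
rewrite ext_cons {1}/tau; case: v => [|d v]; first by left.
move=> H; right; move: H; case: (eqVneq c e) => [_|Hc] /= [<-] {d}.
  move/IH => [->|[v1 [Hv1 Ev]]]; first by exists [::]; split=> //; left.
  exists (e :: v1); rewrite ext_cons /tau eqxx /=; split; first by [].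
  by case: Ev => [->|[E1 E2]]; [left|right; rewrite -E1].
case: v => [_|d v [Ed]]; first by exists [::]; split=> //; left.
subst d => /IH [->|[v1 [Hv1 Ev]]].
  exists [:: c]; rewrite ext_cons /tau (negbTE Hc) /=; split=> //.
  by right.
exists (c :: v1); rewrite ext_cons /tau (negbTE Hc) /=; split; first by lia.
case: Ev => [->|[E1 E2]]; [by left|right; rewrite -E1; split=> //].
by move: E2; case: (v) Hv1.
Qed.

(** * Compositions of elementary standard morphisms and their bispecial factors *)

Definition stdw (T : eqType) (z s : seq T) : seq T := foldr (fun e t => std e t) s z.

Definition stdinf (T : eqType) (z : seq T) (x : nat -> T) : nat -> T :=
  foldr (fun e y => limg (tau e) y) x z.

(* The bispecial factor whose occurrences in [stdinf z x] are the images of the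
   letter boundaries of x; see [occ_bisp]. *)
Definition bisp (T : eqType) (z : seq T) : seq T :=
  foldr (fun e b => std e b ++ [:: e]) [::] z.

Lemma stdw_catl (T : eqType) (z1 z2 s : seq T) : stdw (z1 ++ z2) s = stdw z1 (stdw z2 s).
Proof. exact: foldr_cat. Qed.

Lemma stdw_cat (T : eqType) (z s t : seq T) : stdw z (s ++ t) = stdw z s ++ stdw z t.
Proof. by elim: z => //= e z ->; rewrite ext_cat. Qed.

Lemma stdw_nil (T : eqType) (z : seq T) : stdw z [::] = [::].
Proof. by elim: z => //= e z ->. Qed.

Lemma stdwE (T : eqType) (z s : seq T) : stdw z s = ext (fun c => stdw z [:: c]) s.
Proof.
elim: s => [|c s IH]; first exact: stdw_nil.
by rewrite ext_cons -IH -stdw_cat.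
Qed.

Lemma size_stdw_ge (T : eqType) (z s : seq T) : size s <= size (stdw z s).
Proof.
elim: z => //= e z IH; apply: leq_trans IH _.
exact/size_ext_ge/tau_nonerasing.
Qed.

Lemma stdw_last (T : eqType) (z s : seq T) c :
  exists t, stdw z (s ++ [:: c]) = t ++ [:: c].
Proof.
elim: z => [|e z [t /= ->]] /=; first by exists s.
rewrite ext_cat ext_seq1 /tau; case: eqP => [->|_]; first by eexists.
by exists (std e t ++ [:: e]); rewrite -catA.
Qed.

Lemma stdinfP (T : eqType) (z : seq T) x n :
  stdw z (pre x n) = pre (stdinf z x) (size (stdw z (pre x n))).
Proof.
elim: z => [|e z IH] /=; first by rewrite size_pre.
by rewrite {1}IH (limgP _ (tau_nonerasing e)) -IH.
Qed.

(** Each step of the recursion for [bisp] has the shape decoded by [std_occ], so each letter of [z]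
    costs one desubstitution. *)
Lemma occ_bisp (T : eqType) (z : seq T) x n :
  occ (stdinf z x) (bisp z) n <-> exists m, n = size (stdw z (pre x m)).
Proof.
elim: z n => [|e z IH] n /=; first by split=> // _; exists n; rewrite size_pre.
rewrite (std_occ _ _ (limgP _ (tau_nonerasing e))); split.
  by case=> m [-> /IH [k ->]]; exists k; rewrite -stdinfP.
case=> k ->; exists (size (stdw z (pre x k))); rewrite -stdinfP; split=> //.
by apply/IH; exists k.
Qed.

Lemma size_bisp (T : eqType) (z : seq T) : size z <= size (bisp z).
Proof.
elim: z => //= e z IH; rewrite size_cat addn1 ltnS.
by apply: leq_trans IH _; apply/size_ext_ge/tau_nonerasing.
Qed.

Lemma bisp_cat (T : eqType) (z1 z2 : seq T) :
  bisp (z1 ++ z2) = stdw z1 (bisp z2) ++ bisp z1.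
Proof. by elim: z1 => [|e z1 IH] /=; rewrite ?cats0 // IH ext_cat catA. Qed.

Lemma bisp_prefix (T : eqType) (z s : seq T) :
  exists t, stdw z s ++ bisp z = bisp z ++ t.
Proof.
elim: z => [|e z [t IH]] /=; first by exists s; rewrite cats0.
have [t' Et'] := std_head e t.
by rewrite catA -ext_cat IH ext_cat -catA Et'; exists t'; rewrite -catA.
Qed.

Lemma bisp_mem (T : eqType) (z : seq T) c : c \in z -> c \in bisp z.
Proof.
elim: z => //= e z IH; rewrite in_cons mem_cat mem_seq1 => /orP [->|]; first by rewrite orbT.
move/IH => H; apply/orP; left; elim: (bisp z) H => //= d s IHs.
rewrite ext_cons in_cons mem_cat => /orP [/eqP <-|/IHs ->]; last by rewrite orbT.
by rewrite /tau; case: eqP => [->|_]; rewrite !inE eqxx ?orbT.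
Qed.

Lemma std_boundary_factor (T : eqType) (e a : T) x y v n : isimg (tau e) x y ->
  occ y (a :: v) n -> v = [::] \/ (exists d v', v = d :: v' /\ d != e) \/
  exists v1, size v1 < size v /\ (v = std e v1 ++ [:: e] \/ v = std e v1 /\ last e v != e).
Proof.
move=> H /occ_cons [Ea Ho]; case: v Ho => [|d v] Ho; first by left.
right; have [Ed _] := (occ_cons _ _ _ _).1 Ho.
case: (eqVneq d e) => [Hd|Hd]; last by left; exists d, v.
right; case: (std_position e x n.+1) => m [En|[Hm En]]; last first.
  by move: Ed; rewrite En std_inner // => Ed; rewrite Ed Hd eqxx in Hm.
pose s := pre (shift m x) (size (d :: v)).
have : pre (shift n.+1 y) (size (std e s)) = std e s.
  by rewrite En /s; rewrite -(isimg_shift m H).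
have Hs : size (d :: v) <= size (std e s).
  by apply: leq_trans (size_ext_ge _ (tau_nonerasing e)); rewrite size_pre.
rewrite -{1}(subnKC Hs) preD Ho => E.
by case: (std_parse (esym E)).
Qed.

(** A left special factor is desubstituted together with its two left extensions; the result is
    shorter and again left special. *)
Lemma left_special_prefix (T : eqType) (z : seq T) x v a b n m : a != b ->
  size v <= size z -> occ (stdinf z x) (a :: v) n -> occ (stdinf z x) (b :: v) m ->
  exists t, bisp z = v ++ t.
Proof.
move=> Hab; elim: z v n m => [|e z IH] v n m /=.
  by rewrite leqn0 => /nilP -> _ _; exists [::].
move=> Hv Ha Hb; have H := limgP (stdinf z x) (tau_nonerasing e).
(* One of [a] and [b] differs from [e], and such a letter is always followed by [e]. *)
have Hhd d v' : v = d :: v' -> d = e.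
  move=> E; rewrite {}E in Ha Hb.
  have [Ea /occ_cons [Ed1 _]] := (occ_cons _ _ _ _).1 Ha.
  have [Eb /occ_cons [Ed2 _]] := (occ_cons _ _ _ _).1 Hb.
  case: (eqVneq a e) => [Eae|Nae].
    by rewrite -Ed2; apply: (std_non_e H _).1; rewrite Eb -Eae eq_sym.
  by rewrite -Ed1; apply: (std_non_e H _).1; rewrite Ea.
case: (std_boundary_factor H Ha) => [->|[[d [v' [/Hhd -> /eqP]]] //|[v1 [Hv1 Ev]]]].
  by eexists.
(* If [v] ends in a letter other than [e], the next letter is forced to be [e]; adding it makes both
   occurrences decodable. *)
have [w [Ew Hwa Hwb]] : exists w, [/\ w = std e v1 ++ [:: e] /\ exists t, w = v ++ t,
    occ (limg (tau e) (stdinf z x)) (a :: w) n & occ (limg (tau e) (stdinf z x)) (b :: w) m].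
  case: Ev => [E|[E Hl]]; first by exists v; split=> //; split=> //; exists [::]; rewrite cats0.
  have Hnext c k : occ (limg (tau e) (stdinf z x)) (c :: v) k ->
      occ (limg (tau e) (stdinf z x)) (c :: v ++ [:: e]) k.
    move=> Hc; rewrite -cat_cons; apply/occ_cat; split=> //; apply/occ_cons; split=> //.
    have Hv0 : 0 < size v by lia.
    rewrite /= addnS; apply: (std_non_e H _).1.
    move/occ_cons: Hc => [_ Hc]; move: Hl; rewrite (last_nth e) -Hc; case: (size v) Hv0 => // k' _.
    by rewrite size_pre /= nth_pre // /shift addSnnS.
  exists (v ++ [:: e]); split; try exact: Hnext.
  by rewrite -E; split=> //; exists [:: e].
case: Ew => Ew [t Et]; rewrite Ew in Hwa Hwb.
have [ma Hma] := std_factor_decode H Hwa.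
have [mb Hmb] := std_factor_decode H Hwb.
have [t' ->] := IH v1 ma mb ltac:(lia) Hma Hmb.
have [t'' Et''] := std_head e t'.
exists (t ++ t''); rewrite catA -Et Ew ext_cat -!catA Et''.
by [].
Qed.

(** Both factors desubstitute to a pair of the same kind with a shorter middle word. When [a] is not
    [e], its neighbours inside the first factor are [e], so [v] begins and ends with [e] and is an
    image followed by [e]. *)
Lemma no_unbalanced_pair (T : eqType) (z : seq T) x v a b n m : a != b ->
  size v < size z -> occ (stdinf z x) (a :: v ++ [:: a]) n ->
  occ (stdinf z x) (b :: v ++ [:: b]) m -> False.
Proof.
elim: z v a b n m => [|e z IH] v a b n m Hab //= Hv.
wlog Ha : a b n m Hab / a != e => [W|].
  case: (eqVneq a e) => [Ea|Na]; last exact: W.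
  by move=> H1 H2; apply: (W b a m n) => //; rewrite -?Ea eq_sym.
set y := limg _ _; have H : isimg (tau e) (stdinf z x) y by exact/limgP/tau_nonerasing.
move=> H1 H2.
have [Ea H1'] := (occ_cons _ _ _ _).1 H1.
have [_ H2'] := (occ_cons _ _ _ _).1 H2.
have Enext : y n.+1 = e by apply: (std_non_e H _).1; rewrite Ea.
have [Hv1 /occ_cons [Ela _]] := (occ_cat _ _ _ _).1 H1'.
have Hpv : occ y (a :: v) n by apply/occ_cons.
case: (std_boundary_factor H Hpv) => [E|[[d [v' [E Hd]]]|[v1 [Hs Ev]]]].
- by move: Ela; rewrite E addn0 Enext => E'; rewrite E' eqxx in Ha.
- by move: Hv1; rewrite E => /occ_cons []; rewrite Enext => E'; rewrite E' eqxx in Hd.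
have Elast : last e v = e.
  have := std_non_e H (n := n.+1 + size v); rewrite Ela => /(_ Ha) [_ [_]].
  have Hv0 : 0 < size v by lia.
  have Hk : nth e v (size v).-1 = y (n.+1 + (size v).-1).
    by rewrite -{1}Hv1 nth_pre // prednK.
  by rewrite -nth_last Hk => <-; congr y; lia.
case: Ev => [Ev|[_]]; last by rewrite Elast eqxx.
(* If [c] is [e], it serves as the closing [e] of the decoded shape; otherwise the forced next
   letter [e] is appended first. *)
have Hdec c k : occ y (c :: v ++ [:: c]) k -> exists k', occ (stdinf z x) (c :: v1 ++ [:: c]) k'.
  move=> Hc; case: (eqVneq c e) => [Ec|Nc].
    apply: (std_factor_decode H (n := k)); rewrite ext_cat ext_seq1 /tau Ec eqxx -Ev.
    by rewrite -Ec.
  apply: (std_factor_decode H (n := k)); rewrite ext_cat ext_seq1 /tau (negbTE Nc).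
  have -> : (std e v1 ++ [:: e; c]) ++ [:: e] = (v ++ [:: c]) ++ [:: e] by rewrite Ev -!catA.
  rewrite -cat_cons; apply/occ_cat; split=> //; apply/occ_cons; split=> //.
  have Ek : y (k + (size v).+1) = c by move: Hc; rewrite -cat_cons => /occ_cat [_ /occ_cons []].
  have -> : k + size (c :: v ++ [:: c]) = (k + (size v).+1).+1 by rewrite /= size_cat /=; lia.
  by apply: (std_non_e H _).1; rewrite Ek.
have [ka Ka] := Hdec _ _ H1; have [kb Kb] := Hdec _ _ H2.
by apply: (IH v1 a b ka kb) => //; lia.
Qed.

(** * Balance of binary words *)

Definition ones (s : seq 'I_2) := count_mem b1 s.

Lemma bin_cases (c : 'I_2) : c = b0 \/ c = b1.
Proof. by case: c => [[|[|//]] Hc]; [left|right]; apply: val_inj. Qed.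

Lemma bin_neq (a b c : 'I_2) : a != b -> c = a \/ c = b.
Proof.
by case: (bin_cases a) (bin_cases b) (bin_cases c) => -> [] -> [] -> //; auto.
Qed.

Lemma count_b0 (s : seq 'I_2) : count_mem b0 s + ones s = size s.
Proof.
rewrite -(count_predC (pred1 b0)) /ones; congr addn; apply: eq_count => c /=.
by case: (bin_cases c) => ->.
Qed.

Definition onesat (y : nat -> 'I_2) n k := ones (pre (shift n y) k).

Lemma onesatD y n k l : onesat y n (k + l) = onesat y n k + onesat y (n + k) l.
Proof.
rewrite /onesat preD /ones count_cat; congr addn; congr (count _ _).
by apply: eq_pre => i; rewrite /shift addnA.
Qed.

Lemma onesat1 y n : onesat y n 1 = (y n == b1).
Proof. by rewrite /onesat /ones /pre /= /shift !addn0. Qed.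

(* A shortest pair of equally long factors whose numbers of ones differ by two has the
   form [0v0], [1v1]. *)
Lemma balance (y : nat -> 'I_2) :
  (forall v n m, occ y (b0 :: v ++ [:: b0]) n -> occ y (b1 :: v ++ [:: b1]) m -> False) ->
  forall k n m, onesat y n k <= onesat y m k + 1.
Proof.
move=> NB; elim/ltn_ind => -[|k] IH n m; first by [].
rewrite leqNgt; apply/negP => Hlt.
have := IH k (leqnn _) n.+1 m.+1; move: Hlt.
rewrite -[k.+1]add1n !onesatD !onesat1 !addn1.
case: (bin_cases (y n)) => En; first by rewrite En /=; lia.
case: (bin_cases (y m)) => Em; last by rewrite En Em /=; lia.
rewrite En Em /= => Hlt _.
have [i Hi] : exists i, (i < k) && (y (n.+1 + i) != y (m.+1 + i)).
  case: (boolP [exists i : 'I_k, y (n.+1 + i) != y (m.+1 + i)]) => [/existsP [i Hi]|].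
    by exists i; rewrite ltn_ord.
  rewrite negb_exists => /forallP Hall.
  have E : pre (shift n.+1 y) k = pre (shift m.+1 y) k.
    apply: (@eq_from_nth _ b0); rewrite !size_pre // => i Hi; rewrite !nth_pre //.
    by have /negPn/eqP := Hall (Ordinal Hi).
  by move: Hlt; rewrite /onesat E; lia.
case: (ex_minnP (ex_intro (fun i => _ : bool) i Hi)) => {Hi}i /andP [Hik Hneq] Hmin.
have Ev : pre (shift n.+1 y) i = pre (shift m.+1 y) i.
  apply: (@eq_from_nth _ b0); rewrite !size_pre // => l Hl; rewrite !nth_pre //.
  by apply/eqP/negPn/negP => Hl'; have := Hmin l; rewrite Hl' andbT /shift; lia.
have Ho p c d : y p = c -> y (p.+1 + i) = d -> occ y (c :: pre (shift p.+1 y) i ++ [:: d]) p.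
  move=> Ec Ed; apply/occ_cons; split=> //; apply/occ_cat; split; first exact: occ_pre.
  by rewrite size_pre; apply/occ_cons.
case: (bin_cases (y (n.+1 + i))) (bin_cases (y (m.+1 + i))) => E1 [] E2;
  rewrite E1 E2 // in Hneq.
  have := IH (k - i.+1) ltac:(lia) (n.+1 + i.+1) (m.+1 + i.+1); move: Hlt.
  have -> : k = i + (1 + (k - i.+1)) by lia.
  rewrite !onesatD !onesat1 E1 E2 /onesat Ev -!addnA !addn1 /=.
  have -> : i + (1 + (k - i.+1)) - i.+1 = k - i.+1 by lia.
  by lia.
have := Ho _ _ _ En E1; rewrite Ev => /(NB _ _ _ _) H.
exact: (H m (Ho _ _ _ Em E2)).
Qed.

(** The factor of length [k * m] is cut into [m] blocks of length [k], each compared with the one at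
    [n]. *)
Lemma balance_blocks (y : nat -> 'I_2) n k a m :
  (forall k n m, onesat y n k <= onesat y m k + 1) ->
  m * onesat y n k <= onesat y a (k * m) + m /\ onesat y a (k * m) <= m * onesat y n k + m.
Proof.
move=> Hb; elim: m a => [|m IH] a; first by rewrite muln0.
rewrite mulnS onesatD !mulSn; have := IH (a + k); have := Hb k n a; have := Hb k a n.
by lia.
Qed.

(** Both factors are compared with the prefix of length [k * k'], cut into blocks of either
    length. *)
Lemma balance_cross (y : nat -> 'I_2) n k n' k' :
  (forall k n m, onesat y n k <= onesat y m k + 1) ->
  k' * onesat y n k <= k * onesat y n' k' + k + k'.
Proof.
move=> Hb; have [H1 _] := balance_blocks n k 0 k' Hb.
have [_ H2] := balance_blocks n' k' 0 k Hb; rewrite mulnC in H2.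
by lia.
Qed.

(* [lia] does not identify the two spellings of the carrier of ['I_2] inside [size]. *)
Ltac blia := intros;
  change (Equality.sort (fintype_ordinal__canonical__eqtype_Equality 2)) with 'I_2 in *; lia.

(** * Conjugation of [phi_w w] with a standard morphism *)

Definition base (l : letter) : 'I_2 :=
  match l with La | Lb => b0 | Lalpha | Lbeta => b1 end.

Definition anti (l : letter) : bool :=
  match l with La | Lalpha => true | Lb | Lbeta => false end.

Definition conj1 (l : letter) : seq 'I_2 := if anti l then [:: base l] else [::].

(** For [Lb] and [Lbeta] the two morphisms coincide; for [La] and [Lalpha] each block has its
    [base l] at the end instead of the front. *)
Lemma conj1P l s : std (base l) s ++ conj1 l = conj1 l ++ ext (phi_letter l) s.
Proof.
elim: s => [|c s IH]; first by rewrite cats0.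
rewrite !ext_cons -catA IH !catA; congr (_ ++ _).
by rewrite ffunE /tau; case: l {IH} => /=; case: (bin_cases c) => ->.
Qed.

Definition iphi (w : seq letter) (s : seq 'I_2) := foldr (fun l t => ext (phi_letter l) t) s w.

(** This is the word sigma of the overview. *)
Definition conjw (w : seq letter) : seq 'I_2 :=
  foldr (fun l s => conj1 l ++ ext (phi_letter l) s) [::] w.

Lemma iphi_cat w s t : iphi w (s ++ t) = iphi w s ++ iphi w t.
Proof. by elim: w => //= l w ->; rewrite ext_cat. Qed.

Lemma iphiE w s : ext (phi_w w) s = iphi w s.
Proof.
elim: s => [|c s IH]; first by elim: w => //= l w <-.
by rewrite ext_cons IH ffunE -[c :: s]cat1s iphi_cat.
Qed.

Lemma conjwP w s : stdw (map base w) s ++ conjw w = conjw w ++ iphi w s.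
Proof.
elim: w => [|l w IH] /=; first by rewrite cats0.
by rewrite catA conj1P -catA -ext_cat IH ext_cat catA.
Qed.

Lemma size_iphi w s : size (iphi w s) = size (stdw (map base w) s).
Proof. by have /(congr1 size) := conjwP w s; rewrite !size_cat addnC => /addnI. Qed.

(* [conjw w] is a prefix of the image of p, and p' is what remains: then the prefix p of
   a fixed point u of [phi_w w] is matched with the prefix p' of u. *)
Definition run (w : seq letter) (p p' : seq 'I_2) := stdw (map base w) p = conjw w ++ p'.

Lemma cat_le_split (T : Type) (s s' t t' : seq T) : s ++ t = s' ++ t' ->
  size s' <= size s -> exists r, s = s' ++ r /\ t' = r ++ t.
Proof.
move=> E Hs; exists (drop (size s') s).
have E1 : take (size s') s = s'.
  by have := congr1 (take (size s')) E; rewrite takel_cat // take_size_cat.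
split; first by rewrite -{1}E1 cat_take_drop.
have := E; rewrite -{1}(cat_take_drop (size s') s) E1 -catA => E2.
by case: (catl_inj E2).
Qed.

(** A run splits letter by letter because the partial image of [p] already covers [conjw w]: if it
    were a proper prefix of it, the missing part would still be missing after [tau (base l)] is
    applied. *)
Lemma run_cons l w p p'' : run (l :: w) p p'' <->
  exists p', run w p p' /\ std (base l) p' = conj1 l ++ p''.
Proof.
rewrite /run /= -[_ ++ p'']catA; split; last first.
  by case=> p' [-> E]; rewrite ext_cat E !catA conj1P.
rewrite catA -conj1P -catA => E.
case: (leqP (size (conjw w)) (size (stdw (map base w) p))) => Hs.
  have [p' [Ep' _]] := cat_le_split (conjwP w p) Hs.
  exists p'; split=> //; move: E; rewrite Ep' ext_cat => E.
  by case: (catl_inj E).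
have [t [Et _]] := cat_le_split (esym (conjwP w p)) (ltnW Hs).
move: Hs; rewrite Et size_cat => Hs.
have := congr1 size E; rewrite Et ext_cat !size_cat.
by have := size_ext_ge t (tau_nonerasing (base l)); blia.
Qed.

Lemma run_cat w w' p p'' :
  run (w ++ w') p p'' <-> exists p', run w' p p' /\ run w p' p''.
Proof.
elim: w p'' => [|l w IH] p'' /=.
  by split=> [H|[p' [H]]]; [exists p''|rewrite /run /= => <-].
rewrite run_cons; split.
  case=> q [/IH [p' [H1 H2]] E]; exists p'; split=> //.
  by apply/run_cons; exists q.
case=> p' [H1 /run_cons [q [H2 E]]]; exists q; split=> //.
by apply/IH; exists p'.
Qed.

(** * Growth of runs for words with three letters *)

Definition both (p : seq 'I_2) := (b0 \in p) && (b1 \in p).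

Lemma both_mem p : both p -> forall c, c \in p.
Proof. by case/andP => H0 H1 c; case: (bin_cases c) => ->. Qed.

Lemma both_neq p a b : a != b -> a \in p -> b \in p -> both p.
Proof.
rewrite /both.
by case: (bin_cases a) (bin_cases b) => -> [] -> // _ -> ->.
Qed.

Lemma both_or_const p : both p \/ exists c m, p = nseq m c.
Proof.
case: (boolP (both p)); [by left|rewrite negb_and => H; right].
have [a Ha] : exists a, a \notin p by case/orP: H; [exists b0|exists b1].
have [c Hc] : exists c, a != c by case: (bin_cases a) => ->; [exists b1|exists b0].
exists c, (size p); apply/all_pred1P/allP => d Hd /=.
by case: (bin_neq d Hc) => [E|-> //]; rewrite -E Hd in Ha.
Qed.

Lemma count_std (T : eqType) (e c : T) p :
  count_mem c (std e p) = if c == e then size p else count_mem c p.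
Proof.
elim: p => [|d p IH]; first by case: ifP.
rewrite ext_cons count_cat IH /tau; case: (eqVneq c e) => [->|Hc]; case: (eqVneq d e) => [->|Hd] /=;
  rewrite ?eqxx //= ?[e == c]eq_sym ?(negbTE Hc) ?(negbTE Hd) //=; lia.
Qed.

Lemma size_std (T : eqType) (e : T) p : size (std e p) + count_mem e p = size p + size p.
Proof.
elim: p => //= d p IH; rewrite ext_cons size_cat {1}/tau.
by case: (eqVneq d e) => _ /=; lia.
Qed.

(** Let e be [base l]. Each letter of [p] other than e lengthens the image by one, and at most one
    letter e is removed. The image has as many e as [p] has letters, at least two, so one
    survives. *)
Lemma both_step l p : both p -> exists p', std (base l) p = conj1 l ++ p' /\
  [/\ both p', size p <= size p' & ~~ anti l -> size p < size p'].
Proof.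
move=> Hb; set e := base l.
have [o Ho] : exists o, o != e by case: (bin_cases e) => ->; [exists b1|exists b0].
have Ee : count_mem e (std e p) = size p by rewrite count_std eqxx.
have Eo : count_mem o (std e p) = count_mem o p by rewrite count_std (negbTE Ho).
have Hs := size_std e p.
have He0 : 0 < count_mem e p by rewrite -has_count has_pred1 both_mem.
have Ho0 : 0 < count_mem o p by rewrite -has_count has_pred1 both_mem.
have Hsz : count_mem e p + count_mem o p = size p.
  rewrite -(count_predC (pred1 e)); congr addn; apply: eq_count => c /=.
  by case: (bin_neq c Ho) => ->; rewrite ?eqxx ?(negbTE Ho) // eq_sym (negbTE Ho).
have [p' Ep'] : exists p', std e p = conj1 l ++ p'.
  rewrite /conj1 -/e; case: anti; last by eexists.
  case: (p) He0 => //= c s _; rewrite ext_cons /tau; case: eqP => _; by eexists.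
exists p'; split=> //; rewrite {}Ep' /conj1 -/e in Ee Eo Hs *.
move: Ee Eo Hs; case: anti => /= Ee Eo Hs; rewrite ?eqxx /= ?[e == o]eq_sym ?(negbTE Ho) /= in Ee Eo Hs.
  split=> //; try blia.
  by apply: (both_neq Ho); rewrite -has_pred1 has_count; blia.
split=> //; try blia.
by apply: (both_neq Ho); rewrite -has_pred1 has_count; blia.
Qed.

Lemma both_run w p : both p -> exists p', run w p p' /\
  [/\ both p', size p <= size p' & has (predC anti) w -> size p < size p'].
Proof.
move=> Hb; elim: w => [|l w [q [Hq [Hbq H1 H2]]]] /=; first by exists p.
have [p' [E [Hbp' H3 H4]]] := both_step l Hbq.
exists p'; split; first by apply/run_cons; exists q.
by split=> //; first blia; case/orP => [/H4|/H2]; blia.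
Qed.

Lemma run_inj w p p' p'' : run w p p' -> run w p p'' -> p' = p''.
Proof. by rewrite /run => -> E; case: (catl_inj E). Qed.

(** The image of a power of [c] is the same power if [base l] is [c]; otherwise it is a power of a
    two-letter block, which leaves a constant word only for [m] at most one. *)
Lemma const_step l c m p : std (base l) (nseq m c) = conj1 l ++ p -> both p \/
  exists m', [/\ p = nseq m' c, m' <= m & if base l == c then anti l -> m' < m
    else if anti l then 0 < m /\ m' <= 1 else m' = 0].
Proof.
rewrite /conj1; set e := base l; case: (eqVneq e c) => [->|Hec].
  have -> : std c (nseq m c) = nseq m c.
    by elim: m => //= m IH; rewrite ext_cons IH /tau eqxx.
  case: anti => /= E; last by right; exists m.
  by case: m E => //= m [<-]; right; exists m; split.
have Hce : (c == e) = false by rewrite eq_sym (negbTE Hec).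
case: anti => /=.
  case: m => [|[|m]] //=; rewrite !ext_cons {1}/tau Hce /= => -[<-].
    by right; exists 1.
  by left; apply: (both_neq Hec); rewrite /tau Hce !inE eqxx ?orbT.
case: m => [<-|m /= <-]; first by right; exists 0.
by left; apply: (both_neq Hec); rewrite ext_cons /tau Hce !inE eqxx ?orbT.
Qed.

(** While the word stays constant its length never increases, so the restriction caused by a single
    letter of [w] carries over to the whole run. *)
Lemma const_run w c m p : run w (nseq m c) p -> both p \/
  exists m', [/\ p = nseq m' c, m' <= m & forall l, l \in w ->
    if base l == c then anti l -> m' < m else if anti l then 0 < m /\ m' <= 1 else m' = 0].
Proof.
elim: w p => [|l w IH] p; first by rewrite /run /= => <-; right; exists m.
case/run_cons => q [/IH [Hb|[k [-> Hk Hw]]] E].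
  have [q' [Eq [Hb' _ _]]] := both_step l Hb.
  by left; move: Eq; rewrite E => E'; case: (catl_inj E') => // _ ->.
case: (const_step E) => [|[m' [-> Hm' Hl]]]; [by left|right; exists m'; split=> //; first blia].
move=> l'; rewrite in_cons => /orP [/eqP ->|/Hw].
  by case: eqP Hl => _ ; [move=> H /H|case: anti]; blia.
by case: eqP => _; [move=> H /H|case: anti]; blia.
Qed.

Lemma three_letters (w : seq letter) : 2 < size (undup w) ->
  forall l l', l != l' -> (l \in w) || (l' \in w).
Proof.
move=> Hw l l' Hl; apply/negPn/negP; rewrite negb_or => /andP [H H'].
pose s := [seq k <- [:: La; Lb; Lalpha; Lbeta] | (k != l) && (k != l')].
have : size (undup w) <= size s.
  apply: uniq_leq_size (undup_uniq w) _ => k; rewrite mem_undup => Hk.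
  rewrite mem_filter; apply/andP; split; last by case: (k).
  by apply/andP; split; apply/eqP => E; rewrite -E Hk in H H'.
by move: Hw; rewrite /s; case: l l' Hl {H H' s} => -[] //=; blia.
Qed.

(** Suppose that all the words are powers of 0. Then [Lbeta] forces length zero after a round, [La]
    a strict decrease, and [Lalpha] a positive length before and at most one after. With at most one
    letter missing from [w], three rounds are contradictory. For powers of 1 these roles pass to
    [Lb], [Lalpha] and [La]. *)
Lemma run_three_cycles w p0 p1 p2 p3 : 2 < size (undup w) ->
  run w p0 p1 -> run w p1 p2 -> run w p2 p3 -> both p3.
Proof.
move=> Hw R1 R2 R3.
have Hb p p' : run w p p' -> both p -> both p'.
  by move=> R /(both_run w) [q [R' [Hq _ _]]]; rewrite (run_inj R R').
have [H0|[c [m E0]]] := both_or_const p0; first exact: (Hb _ _ R3 (Hb _ _ R2 (Hb _ _ R1 H0))).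
rewrite {}E0 in R1; have [H1|[m1 [E1 _ F1]]] := const_run R1; first exact: (Hb _ _ R3 (Hb _ _ R2 H1)).
rewrite {}E1 in R2; have [H2|[m2 [E2 _ F2]]] := const_run R2; first exact: (Hb _ _ R3 H2).
rewrite {}E2 in R3; have [//|[m3 [E3 _ F3]]] := const_run R3.
have H3 := three_letters Hw; exfalso; move: F1 F2 F3.
case: (bin_cases c) => -> F1 F2 F3.
- case: (boolP (Lbeta \in w)) => Hbeta.
    have := F1 _ Hbeta => /= E; subst m1.
    case: (boolP (La \in w)) => Ha; first by have := F2 _ Ha isT.
    have := H3 La Lalpha isT; rewrite (negbTE Ha) /= => /F2 /=; blia.
  have := H3 Lbeta La isT; have := H3 Lbeta Lalpha isT; rewrite (negbTE Hbeta) /= => Halpha Ha.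
  by have := F1 _ Halpha; have := F2 _ Ha isT; have := F3 _ Ha isT => /=; blia.
- case: (boolP (Lb \in w)) => Hbeta.
    have := F1 _ Hbeta => /= E; subst m1.
    case: (boolP (Lalpha \in w)) => Ha; first by have := F2 _ Ha isT.
    have := H3 Lalpha La isT; rewrite (negbTE Ha) /= => /F2 /=; blia.
  have := H3 Lb La isT; have := H3 Lb Lalpha isT; rewrite (negbTE Hbeta) /= => Ha Halpha.
  by have := F1 _ Halpha; have := F2 _ Ha isT; have := F3 _ Ha isT => /=; blia.
Qed.

Definition wpow (A : Type) (n : nat) (w : seq A) : seq A := flatten (nseq n w).

(** Three rounds produce both letters; every later round lengthens the word, as [w] contains [Lb] or
    [Lbeta]. *)
Lemma run_growth w n p p' : 2 < size (undup w) -> run (wpow (n + 3) w) p p' ->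
  both p' /\ n <= size p'.
Proof.
move=> Hw; elim: n p' => [|n IH] p'.
  rewrite /wpow /= cats0 => /run_cat [p2 [/run_cat [p1 [R1 R2]] R3]].
  by split=> //; apply: run_three_cycles R1 R2 R3.
case/run_cat => q [/IH [Hb Hn] R].
have [q' [R' [Hb' _ Hs]]] := both_run w Hb; rewrite (run_inj R R'); split=> //.
suff /Hs : has (predC anti) w by blia.
have /orP [Hl|Hl] := three_letters Hw (l := Lb) (l' := Lbeta) isT; apply/hasP; by eexists; eauto.
Qed.

Lemma wpowS (A : Type) n (w : seq A) : wpow n.+1 w = w ++ wpow n w.
Proof. by []. Qed.

Lemma wpowD (A : Type) m n (w : seq A) : wpow (m + n) w = wpow m w ++ wpow n w.
Proof. by rewrite /wpow nseqD flatten_cat. Qed.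

Lemma map_wpow (A B : Type) (f : A -> B) n w : map f (wpow n w) = wpow n (map f w).
Proof. by elim: n => //= n IH; rewrite wpowS map_cat IH. Qed.

Lemma size_wpow (A : Type) n (w : seq A) : size (wpow n w) = n * size w.
Proof. by elim: n => // n IH; rewrite wpowS size_cat IH mulSn. Qed.

(** * Words that are tails of their images under powers of a standard morphism *)

Definition recurrent_letters (u : nat -> 'I_2) := forall N c, exists i, N <= i /\ u i = c.

Definition tail_of (k : nat) (z : seq 'I_2) (u : nat -> 'I_2) :=
  forall i, stdinf z u (k + i) = u i.

(** All powers of [Z] are present so that [u] can be desubstituted arbitrarily often and contains
    every [bisp (wpow N Z)]; balance and aperiodicity follow. *)
Record characteristic (Z : seq 'I_2) (u : nat -> 'I_2) : Prop := Characteristic {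
  char_both : both Z;
  char_rec : recurrent_letters u;
  char_tail : forall N, exists k, tail_of k (wpow N Z) u }.

Lemma iphi_fix_iter w u n :
  (forall n, iphi w (pre u n) = pre u (size (iphi w (pre u n)))) ->
  forall m, iphi (wpow n w) (pre u m) = pre u (size (iphi (wpow n w) (pre u m))).
Proof.
move=> H m; elim: n => [|n IH]; first by rewrite size_pre.
rewrite wpowS /iphi foldr_cat -/(iphi _ _) -/(iphi _ _) IH.
exact: H.
Qed.

(** By [conjwP] on prefixes of [u], the standard image of [u] is sigma followed by [u]. *)
Lemma fix_tail w u : (forall n, iphi w (pre u n) = pre u (size (iphi w (pre u n)))) ->
  tail_of (size (conjw w)) (map base w) u.
Proof.
move=> H i; set k := size _; set n := (k + i).+1.
have Hn : k + i < size (stdw (map base w) (pre u n)).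
  by apply: leq_trans (size_stdw_ge _ _); rewrite size_pre.
have E := conjwP w (pre u n); rewrite H size_iphi in E.
rewrite -(@nth_pre _ b0 _ (size (stdw (map base w) (pre u n)))) // -stdinfP.
transitivity (nth b0 (stdw (map base w) (pre u n) ++ conjw w) (k + i)).
  by rewrite nth_cat ifT.
rewrite E.
rewrite nth_cat ifF; last by rewrite -/k; blia.
by rewrite -/k addKn nth_pre //; blia.
Qed.

Lemma recurrent_shift u j : recurrent_letters u -> recurrent_letters (shift j u).
Proof.
move=> Hr N c; have [i [Hi Ei]] := Hr (j + N) c; have Hji : j <= i by lia.
by exists (i - j); rewrite /shift subnKC //; split=> //; lia.
Qed.

Lemma recurrent_pairs u : recurrent_letters u -> forall N a b, a != b ->
  exists i, [/\ N <= i, u i = a & u i.+1 = b].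
Proof.
move=> H N a b Hab; have [i [Hi Ei]] := H N a; have [k [Hk Ek]] := H i b.
have Hex : exists k, (i <= k) && (u k == b) by exists k; rewrite Hk Ek eqxx.
case: (ex_minnP Hex) => {Hk Ek}k /andP [Hk /eqP Ek] Hmin.
case: k Hk Ek Hmin => [|k] Hk Ek Hmin.
  have E : i = 0 by blia.
  by move: Hab; rewrite -Ei E Ek eqxx.
have Hik : i <= k.
  rewrite leqNgt; apply/negP => Hki; have E : i = k.+1 by blia.
  by move: Hab; rewrite -Ei E Ek eqxx.
exists k; split=> //; first by blia.
case: (bin_neq (u k) Hab) => // E.
by have := Hmin k; rewrite E eqxx Hik => /(_ isT); rewrite ltnn.
Qed.

(** On two letters, ab is sent to aab by [tau a] and to bab by [tau b]; both end in ab. *)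
Lemma stdw_last2 (z : seq 'I_2) a b : a != b -> exists t, stdw z [:: a; b] = t ++ [:: a; b].
Proof.
move=> Hab; elim: z => [|e z [t IH]] /=; first by exists [::].
rewrite IH ext_cat ext_cons ext_seq1 /tau.
case: (bin_neq e Hab) => ->; rewrite eqxx ?(negbTE Hab) 1?eq_sym ?(negbTE Hab).
  by exists (std a t ++ [:: a]); rewrite -catA.
by exists (std b t ++ [:: b]); rewrite -catA.
Qed.

Lemma occ_tail k z u v n : tail_of k z u -> occ u v n <-> occ (stdinf z u) v (k + n).
Proof. by move=> H; apply: eq_occ => i; rewrite -addnA H. Qed.

(** The image of a prefix ending in ab again ends in ab, and [bisp z] follows it. Applied to ab and
    ba, this makes [bisp z] left special. *)
Lemma occ_extended_bisp k z u N a b : tail_of k z u -> recurrent_letters u -> a != b ->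
  exists n, N <= n /\ occ u ([:: a; b] ++ bisp z) n.
Proof.
move=> Ht Hr Hab; have [i [Hi Ea Eb]] := recurrent_pairs Hr (N + k) Hab.
have [t Et] := stdw_last2 z Hab.
have Ep : pre u i.+2 = pre u i ++ [:: a; b] by rewrite !preS Ea Eb -catA.
set n := size (stdw z (pre u i) ++ t).
have Hn : i <= n.
  by rewrite /n size_cat; have := size_stdw_ge z (pre u i); rewrite size_pre; blia.
exists (n - k); split; first by blia.
apply/(occ_tail _ _ Ht); have -> : k + (n - k) = n by blia.
have E : stdw z (pre u i.+2) = (stdw z (pre u i) ++ t) ++ [:: a; b].
  by rewrite Ep stdw_cat Et catA.
apply/occ_cat; split.
  have : occ (stdinf z u) (stdw z (pre u i.+2)) 0 by rewrite /occ -stdinfP.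
  by rewrite E => /occ_cat [_].
by apply/occ_bisp; exists i.+2; rewrite E size_cat.
Qed.

Lemma characteristic_large Z u N : characteristic Z u ->
  exists z k, [/\ N <= size z, N <= size (bisp z) & tail_of k z u].
Proof.
move=> H; have [k Hk] := char_tail H N; exists (wpow N Z), k.
have Hs : N <= size (wpow N Z).
  rewrite size_wpow leq_pmulr //.
  by have := both_mem (char_both H) b0; case: (Z).
by split=> //; apply: leq_trans Hs (size_bisp _).
Qed.

(** If [u] eventually had a period d, the letter before a far occurrence of a bispecial factor of
    length at least d would be its letter of index d-1. But both letters precede it arbitrarily far
    out. *)
Lemma characteristic_aperiodic Z u a b : characteristic Z u ->
  shift a u =1 shift b u -> a = b.
Proof.
move=> H; wlog Hab : a b / a < b => [W E|].
  by case: (ltngtP a b) => // Hab; [|apply/esym]; apply: W => // i; rewrite E.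
move=> E; exfalso; have [z [k [_ Hs Ht]]] := characteristic_large (b - a) H.
have Hlast c d : c != d -> d = nth b0 (bisp z) (b - a).-1.
  move=> Hcd; have [n [Hn]] := occ_extended_bisp a Ht (char_rec H) Hcd.
  case/occ_cons => _ /= /occ_cons [<- Ho].
  have := E (n.+1 - a); rewrite /shift.
  have -> : a + (n.+1 - a) = n.+1 by blia.
  move=> ->; rewrite -Ho nth_pre /shift; last by blia.
  by congr u; blia.
by have := Hlast b0 b1 isT; rewrite -(Hlast b1 b0 isT).
Qed.

Lemma characteristic_balance Z u : characteristic Z u ->
  forall k n m, onesat u n k <= onesat u m k + 1.
Proof.
move=> H; apply: balance => v n m Hn Hm.
have [z [k [Hs _ Ht]]] := characteristic_large (size v).+1 H.
apply: (@no_unbalanced_pair _ z u v b0 b1 (k + n) (k + m)) => //; by apply/(occ_tail _ _ Ht).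
Qed.

(** * Prefixes of the characteristic word *)

Definition charprefix (Z v : seq 'I_2) := exists N t, bisp (wpow N Z) = v ++ t.

Lemma charprefix_left_special Z u v a b n m : characteristic Z u -> a != b ->
  occ u (a :: v) n -> occ u (b :: v) m -> charprefix Z v.
Proof.
move=> H Hab Hn Hm.
(* As many copies of [Z] as [v] has letters meet the length condition of [left_special_prefix]. *)
have [k Ht] := char_tail H (size v); exists (size v).
apply: (@left_special_prefix _ (wpow (size v) Z) u v a b (k + n) (k + m)) => //; try by apply/(occ_tail _ _ Ht).
rewrite size_wpow leq_pmulr //.
by have := both_mem (char_both H) b0; case: (Z).
Qed.

Lemma charprefix_catl Z v t : charprefix Z (v ++ t) -> charprefix Z v.
Proof. by case=> N [t' E]; exists N, (t ++ t'); rewrite E catA. Qed.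

Lemma bisp_wpow_prefix (Z : seq 'I_2) N M : exists t, bisp (wpow (N + M) Z) = bisp (wpow N Z) ++ t.
Proof. by rewrite wpowD bisp_cat; apply: bisp_prefix. Qed.

Lemma charprefix_eq Z v v' : charprefix Z v -> charprefix Z v' -> size v = size v' -> v = v'.
Proof.
move=> [N [t E]] [M [t' E']] Hs.
have [r Er] := bisp_wpow_prefix Z N M; have [r' Er'] := bisp_wpow_prefix Z M N.
rewrite addnC Er E E' -!catA in Er'.
by case: (catl_inj Er').
Qed.

(** By [bisp_cat], the image of each bispecial factor is a prefix of the next one. *)
Lemma charprefix_stdw Z v : charprefix Z v -> charprefix Z (stdw Z v).
Proof.
case=> N [t E]; exists N.+1, (stdw Z t ++ bisp Z).
by rewrite wpowS bisp_cat E stdw_cat catA.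
Qed.

Lemma charprefix_stdw_wpow Z K v : charprefix Z v -> charprefix Z (stdw (wpow K Z) v).
Proof.
elim: K => // K IH /IH H; rewrite wpowS stdw_catl; exact: charprefix_stdw.
Qed.

Lemma charprefix_occ Z u v : characteristic Z u -> charprefix Z v -> exists n, occ u v n.
Proof.
move=> H [N [t E]]; have [k Ht] := char_tail H N.
have [n [_ /occ_cat [_]]] := occ_extended_bisp 0 Ht (char_rec H) (isT : b0 != b1).
by rewrite E => /occ_cat [Ho _]; eexists; exact: Ho.
Qed.

Lemma charprefix_letter Z u c : characteristic Z u -> exists v, charprefix Z (v ++ [:: c]).
Proof.
move=> H; have := bisp_mem (both_mem (char_both H) c); move E: (bisp Z) => s Hs.
case/splitPr: Hs E => v t E; exists v, 1, t.
by rewrite wpowS cats0 E -catA.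
Qed.

(** * Letter weights and incidence matrices *)

Definition step (r : int * int) (e : 'I_2) : int * int :=
  if e == b0 then (r.1, (r.1 + r.2)%R) else ((r.1 + r.2)%R, r.2).

(** The pair [r] is a row vector of letter weights, and [step r e] is its product with the incidence
    matrix of [tau e]. *)
Definition lam (r : int * int) (s : seq 'I_2) : int :=
  (r.1 * (count_mem b0 s)%:Z + r.2 * (ones s)%:Z)%R.

Lemma lam_cat r s t : lam r (s ++ t) = (lam r s + lam r t)%R.
Proof. by rewrite /lam /ones !count_cat !PoszD; ring. Qed.

Lemma lam_std r e s : lam r (std e s) = lam (step r e) s.
Proof.
rewrite /lam /step /ones !count_std -count_b0 /ones.
by case: (bin_cases e) => -> /=; rewrite PoszD; ring.
Qed.

Lemma lam_stdw r z s : lam r (stdw z s) = lam (foldl step r z) s.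
Proof. by elim: z r => //= e z IH r; rewrite lam_std IH. Qed.

Definition nonneg (r : int * int) := [/\ (0 <= r.1)%R, (0 <= r.2)%R & (0 < r.1 + r.2)%R].

Definition negp (r : int * int) : int * int := ((- r.1)%R, (- r.2)%R).

Lemma step_neg r e : step (negp r) e = negp (step r e).
Proof. by rewrite /step /negp; case: ifP => _ /=; congr pair; ring. Qed.

Lemma foldl_step_neg r z : foldl step (negp r) z = negp (foldl step r z).
Proof. by elim: z r => //= e z IH r; rewrite step_neg IH. Qed.

Lemma nonneg_step r e : nonneg r ->
  [/\ nonneg (step r e), (r.1 <= (step r e).1)%R & (r.2 <= (step r e).2)%R].
Proof. by rewrite /nonneg /step => -[H1 H2 H3]; case: ifP => _ /=; split=> //; try split; lia. Qed.

Lemma nonneg_foldl r z : nonneg r ->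
  [/\ nonneg (foldl step r z), (r.1 <= (foldl step r z).1)%R & (r.2 <= (foldl step r z).2)%R].
Proof.
elim: z r => //= e z IH r /(nonneg_step e) [H H1 H2].
by have [H' H1' H2'] := IH _ H; split=> //; lia.
Qed.

Lemma nonneg_foldl2 r z : nonneg r -> b0 \in z -> (0 < r.1)%R -> (r.2 < (foldl step r z).2)%R.
Proof.
elim: z r => //= e z IH r H; have [H' H1' H2'] := nonneg_step e H.
rewrite in_cons => /orP [/eqP E|Hz] Hr.
  have [_ _] := nonneg_foldl z H'; rewrite -E /step /=; lia.
by have := IH _ H' Hz; lia.
Qed.

Lemma nonneg_foldl1 r z : nonneg r -> b1 \in z -> (0 < r.2)%R -> (r.1 < (foldl step r z).1)%R.
Proof.
elim: z r => //= e z IH r H; have [H' H1' H2'] := nonneg_step e H.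
rewrite in_cons => /orP [/eqP E|Hz] Hr.
  have [_ + _] := nonneg_foldl z H'; rewrite -E /step /=; lia.
by have := IH _ H' Hz; lia.
Qed.

Lemma nonneg_wpow r z K : both z -> nonneg r ->
  (K%:Z + r.1 + r.2 <= (foldl step r (wpow K z)).1 + (foldl step r (wpow K z)).2)%R.
Proof.
move=> Hz; elim: K r => [|K IH] r Hr; first by rewrite /=; lia.
rewrite wpowS foldl_cat; have [Hr' H1 H2] := nonneg_foldl z Hr.
have := IH _ Hr'; case: Hr => R1 R2 R3.
suff : (r.1 + r.2 < (foldl step r z).1 + (foldl step r z).2)%R by lia.
case: (boolP (0 < r.1)%R) => Hr1.
  by have := nonneg_foldl2 (And3 R1 R2 R3) (both_mem Hz b0) Hr1; lia.
have Hr2 : (0 < r.2)%R by lia.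
by have := nonneg_foldl1 (And3 R1 R2 R3) (both_mem Hz b1) Hr2; lia.
Qed.

(* While the two coordinates have opposite signs, each step is one subtraction of the
   Euclidean algorithm. *)
Lemma foldl_step_sign r z : r <> (0%R, 0%R) -> absz r.1 + absz r.2 <= size z ->
  nonneg (foldl step r z) \/ nonneg (negp (foldl step r z)).
Proof.
elim: z r => [|e z IH] [r1 r2] Hr Hs.
  have [E1 E2] : r1 = 0%R /\ r2 = 0%R by move: Hs => /=; lia.
  by case: Hr; rewrite E1 E2.
rewrite /=.
have Hfold r' : nonneg r' \/ nonneg (negp r') ->
    nonneg (foldl step r' z) \/ nonneg (negp (foldl step r' z)).
  by case=> [|] /(nonneg_foldl z) [H _ _]; [left|right; rewrite -foldl_step_neg].
have [H|H] : (nonneg (step (r1, r2) e) \/ nonneg (negp (step (r1, r2) e))) \/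
   (step (r1, r2) e <> (0%R, 0%R) /\
    absz (step (r1, r2) e).1 + absz (step (r1, r2) e).2 < absz r1 + absz r2).
- have Hr' : r1 != 0%R \/ r2 != 0%R.
    case: (eqVneq r1 0%R) => [E1|]; last by left.
    by case: (eqVneq r2 0%R) => [E2|]; [case: Hr; rewrite E1 E2|right].
  rewrite /step /nonneg /negp; case: ifP => _ /=.
    case: (boolP ((0 <= r1) && (0 <= r1 + r2))%R) => H1; first by left; left; split; lia.
    case: (boolP ((r1 <= 0) && (r1 + r2 <= 0))%R) => H2; first by left; right; split; lia.
    by right; split; [case; lia|lia].
  case: (boolP ((0 <= r2) && (0 <= r1 + r2))%R) => H1; first by left; left; split; lia.
  case: (boolP ((r2 <= 0) && (r1 + r2 <= 0))%R) => H2; first by left; right; split; lia.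
  by right; split; [case; lia|lia].
- exact: Hfold.
by case: H => H1 H2; apply: IH => //; rewrite -ltnS; apply: leq_trans H2 Hs.
Qed.

(** After A passes the two weights no longer have opposite signs; from then on the absolute value of
    their sum grows by at least one per pass. *)
Lemma step_unbounded r z (M : nat) : both z -> r <> (0%R, 0%R) ->
  exists K, M < absz (foldl step r (wpow K z)).1 + absz (foldl step r (wpow K z)).2.
Proof.
move=> Hz Hr; set A := absz r.1 + absz r.2.
have Hsz : A <= size (wpow A z).
  rewrite size_wpow leq_pmulr //; by have := both_mem Hz b0; case: (z).
exists (A + M.+1); rewrite wpowD foldl_cat.
case: (foldl_step_sign Hr Hsz) => Hn; have := nonneg_wpow M.+1 Hz Hn; case: Hn => [_ _]; first by lia.
by rewrite foldl_step_neg /=; lia.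
Qed.

(** * Commutation with morphisms that preserve characteristic prefixes *)

Lemma size_extE (h : 'I_2 -> seq 'I_2) s :
  size (ext h s) = count_mem b0 s * size (h b0) + ones s * size (h b1).
Proof.
elim: s => //= c s IH; rewrite ext_cons size_cat IH /ones.
by case: (bin_cases c) => -> /=; lia.
Qed.

Lemma lam_sizes (h h' : 'I_2 -> seq 'I_2) s :
  lam ((size (h b0))%:Z - (size (h' b0))%:Z, (size (h b1))%:Z - (size (h' b1))%:Z)%R s =
  ((size (ext h s))%:Z - (size (ext h' s))%:Z)%R.
Proof. by rewrite !size_extE /lam /= !PoszD !PoszM; ring. Qed.

Lemma charprefix_cross Z u v v' : characteristic Z u -> charprefix Z v -> charprefix Z v' ->
  size v' * ones v <= size v * ones v' + size v + size v'.
Proof.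
move=> H /(charprefix_occ H) [n Hn] /(charprefix_occ H) [m Hm].
have := balance_cross n (size v) m (size v') (characteristic_balance H).
by rewrite /onesat Hn Hm.
Qed.

(** Here a, b and c, d are the letter lengths of F and G; (n, p), (m, q) and (k, r) are the length
    and number of ones of v, G(v) and F(v); X and Y are the lengths of FG(v) and GF(v). The identity
    [E] expresses (X - Y)n by two balance defects, each at most linear in n, so the bound on X - Y
    does not depend on v. *)
Lemma commutator_bound (a b c d n p m q k r X Y : int) :
  (0 <= a -> 0 <= b -> 0 <= c -> 0 <= d -> 0 <= p -> p <= n ->
  m = c * (n - p) + d * p -> k = a * (n - p) + b * p ->
  X = a * (m - q) + b * q -> Y = c * (k - r) + d * r ->
  `|n * q - m * p| <= n + m -> `|n * r - k * p| <= n + k ->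
  0 < n ->
  `|X - Y| <= (a + b) * (1 + c + d) + (c + d) * (1 + a + b))%R.
Proof.
move=> a0 b0 c0 d0 p0 pn Em Ek EX EY Hq Hr n0.
have E : ((X - Y) * n = (b - a) * (n * q - m * p) - (d - c) * (n * r - k * p))%R.
  by rewrite EX EY Em Ek; ring.
have Hm : (m <= (c + d) * n)%R by rewrite Em; nia.
have Hk : (k <= (a + b) * n)%R by rewrite Ek; nia.
have Hn : (`|X - Y| * n = `|(X - Y) * n|)%R by rewrite normrM [X in (_ = _ * X)%R]ger0_norm //; lia.
rewrite -(ler_pM2r n0) Hn E; apply: le_trans (ler_normB _ _) _; rewrite !normrM.
have H1 : (`|b - a| * `|n * q - m * p| <= (a + b) * ((1 + c + d) * n))%R.
  by apply: ler_pM => //; lia.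
have H2 : (`|d - c| * `|n * r - k * p| <= (c + d) * ((1 + a + b) * n))%R.
  by apply: ler_pM => //; lia.
by lia.
Qed.

Lemma ext_comp (T : Type) (f g : T -> seq T) s : ext (fun c => ext f (g c)) s = ext f (ext g s).
Proof. by elim: s => //= c s IH; rewrite !ext_cons ext_cat IH. Qed.

Lemma size_ext_ones (h : 'I_2 -> seq 'I_2) s : ((size (ext h s))%:Z =
  (size (h b0))%:Z * ((size s)%:Z - (ones s)%:Z) + (size (h b1))%:Z * (ones s)%:Z)%R.
Proof. by rewrite size_extE -(count_b0 s) !PoszD !PoszM; ring. Qed.

Lemma commutator_lam_bound Z u (G : 'I_2 -> seq 'I_2) : characteristic Z u ->
  (forall v, charprefix Z v -> charprefix Z (ext G v)) ->
  exists C, forall v, charprefix Z v ->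
    absz ((size (stdw Z (ext G v)))%:Z - (size (ext G (stdw Z v)))%:Z)%R <= C.
Proof.
move=> H HG; pose F c := stdw Z [:: c].
have EF s : stdw Z s = ext F s by exact: stdwE.
pose a := size (F b0); pose b := size (F b1); pose c := size (G b0); pose d := size (G b1).
exists ((a + b) * (1 + c + d) + (c + d) * (1 + a + b)) => v Hv.
case: (posnP (size v)) => [/size0nil ->|Hn]; first by rewrite !stdw_nil.
have HGv := HG _ Hv; have HFv := charprefix_stdw Hv; rewrite EF in HFv.
have Hp s : ones s <= size s by rewrite /ones count_size.
have X1 := charprefix_cross H Hv HGv; have X2 := charprefix_cross H HGv Hv.
have X3 := charprefix_cross H Hv HFv; have X4 := charprefix_cross H HFv Hv.
have := @commutator_bound a%:Z b%:Z c%:Z d%:Z (size v)%:Z (ones v)%:Z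
  (size (ext G v))%:Z (ones (ext G v))%:Z (size (ext F v))%:Z (ones (ext F v))%:Z
  (size (ext F (ext G v)))%:Z (size (ext G (ext F v)))%:Z isT isT isT isT isT (Hp v)
  (size_ext_ones _ _) (size_ext_ones _ _) (size_ext_ones _ _) (size_ext_ones _ _).
rewrite !EF; move: X1 X2 X3 X4 Hn.
set x1 := size v; set x2 := ones v; set x3 := size (ext G v); set x4 := ones (ext G v).
set x5 := size (ext F v); set x6 := ones (ext F v).
set x7 := size (ext F _); set x8 := size (ext G (ext F v)).
move=> X1 X2 X3 X4 Hn W; have := W ltac:(lia) ltac:(lia) Hn; lia.
Qed.

(** The length difference of FG and GF is a weight [r], bounded on characteristic prefixes and hence
    on all F^K(c); a nonzero [r] would be unbounded there. So the lengths agree, and for a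
    characteristic prefix v both FG(v) and GF(v) are prefixes of the same word. *)
Lemma stdw_commute Z u (G : 'I_2 -> seq 'I_2) : characteristic Z u ->
  (forall v, charprefix Z v -> charprefix Z (ext G v)) ->
  forall s, stdw Z (ext G s) = ext G (stdw Z s).
Proof.
move=> H HG.
pose FG c := stdw Z (G c); pose GF c := ext G (stdw Z [:: c]).
have EFG s : ext FG s = stdw Z (ext G s).
  rewrite stdwE -ext_comp /ext; congr flatten; apply: eq_map => c; exact: stdwE.
have EGF s : ext GF s = ext G (stdw Z s) by rewrite ext_comp -stdwE.
have [C HC] := commutator_lam_bound H HG.
pose r := ((size (FG b0))%:Z - (size (GF b0))%:Z, (size (FG b1))%:Z - (size (GF b1))%:Z)%R.
have Hlam s : charprefix Z s -> absz (lam r s) <= C.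
  by move=> Hs; rewrite /r lam_sizes EFG EGF; apply: HC.
have Hlet K c : absz (lam r (stdw (wpow K Z) [:: c])) <= C + C.
  have [v Hv] := charprefix_letter c H.
  have := Hlam _ (charprefix_stdw_wpow K Hv).
  have := Hlam _ (charprefix_stdw_wpow K (charprefix_catl Hv)).
  rewrite stdw_cat lam_cat; move: (lam r (stdw _ v)) (lam r (stdw _ [:: c])) => A B; lia.
have Hr : r = (0%R, 0%R).
  case: (eqVneq r (0%R, 0%R)) => // /eqP Hr; exfalso.
  (* The weight of F^K(c) is one coordinate of the transformed [r], so each of the two coordinates
     is at most 2C in absolute value. *)
  have [K] := step_unbounded (C + C + (C + C)) (char_both H) Hr.
  have := Hlet K b0; have := Hlet K b1; rewrite !lam_stdw /lam /=.
  by lia.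
have Hsz s : size (ext FG s) = size (ext GF s).
  by have := lam_sizes FG GF s; rewrite -/r Hr /lam /=; lia.
have Hpre s : charprefix Z s -> ext FG s = ext GF s.
  move=> Hs; apply: (@charprefix_eq Z) (Hsz s).
    by rewrite EFG; apply/charprefix_stdw/HG.
  by rewrite EGF; apply/HG/charprefix_stdw.
have Hc c : FG c = GF c.
  have [v Hv] := charprefix_letter c H.
  have := Hpre _ Hv; rewrite !ext_cat !ext_seq1 (Hpre _ (charprefix_catl Hv)).
  by move=> /eqP; rewrite eqseq_cat // eqxx => /eqP.
move=> s; rewrite -EFG -EGF /ext; congr flatten; exact: eq_map.
Qed.

(** * Conjugation by a longest common suffix, and the contradiction *)

Lemma common_suffix (T : eqType) (s t : seq T) : size s = size t -> s != t ->
  exists p q a b r, [/\ s = p ++ a :: r, t = q ++ b :: r & a != b].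
Proof.
elim/last_ind: s t => [|s a IH] t; first by case: t.
case/lastP: t => [|t b]; rewrite !size_rcons // => -[Hs].
case: (eqVneq a b) => [->|Hab] Hst.
  have Hst' : s != t by apply: contra Hst => /eqP ->.
  have [p [q [a' [b' [r [-> -> Hab]]]]]] := IH t Hs Hst'.
  by exists p, q, a', b', (rcons r b); rewrite !rcons_cat.
by exists s, t, a, b, [::]; rewrite !cats1.
Qed.

Lemma suffix_split (T : Type) (s s' t t' : seq T) : s ++ t = s' ++ t' ->
  size t' <= size t -> exists r, t = r ++ t' /\ s' = s ++ r.
Proof.
move=> E Ht; have Hs : size s <= size s'.
  by have := congr1 size E; rewrite !size_cat; lia.
have [r [E1 E2]] := cat_le_split (esym E) Hs.
by exists r.
Qed.

(* Let r be the longest common suffix of h(01) and h(10).  What is left of r after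
   removing a suffix h(c) is again a suffix of both words, hence of r. *)
Lemma conjugate_morphism (h : 'I_2 -> seq 'I_2) : h b0 ++ h b1 != h b1 ++ h b0 ->
  exists G r p q a b, [/\ forall s, ext G s ++ r = r ++ ext h s,
    forall c, size (G c) = size (h c), h b0 ++ h b1 = p ++ a :: r,
    h b1 ++ h b0 = q ++ b :: r & a != b].
Proof.
move=> Hneq.
have [] := common_suffix _ Hneq; first by rewrite !size_cat addnC.
move=> p [q [a [b [r [E1 E2 Hab]]]]].
have key s t p' q' : s ++ t = p' ++ r -> t ++ s = q' ++ r -> exists g, r ++ t = g ++ r.
  move=> F1 F2; case: (leqP (size r) (size t)) => Hs.
    have [x [-> _]] := suffix_split F1 Hs.
    by exists (r ++ x); rewrite catA.
  have [x [Ex Es]] := suffix_split (esym F1) (ltnW Hs).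
  have : (q' ++ r) = (t ++ p') ++ x by rewrite -F2 Es catA.
  move/suffix_split => /(_ _) [].
    by rewrite Ex size_cat leq_addr.
  by move=> y [Ey _]; exists y; rewrite {1}Ey Ex catA.
have [g1 Eg1] := key (h b0) (h b1) (p ++ [:: a]) (q ++ [:: b]) ltac:(by rewrite -catA) ltac:(by rewrite -catA).
have [g0 Eg0] := key (h b1) (h b0) (q ++ [:: b]) (p ++ [:: a]) ltac:(by rewrite -catA) ltac:(by rewrite -catA).
pose G (c : 'I_2) := if c == b0 then g0 else g1.
have EG c : r ++ h c = G c ++ r by case: (bin_cases c) => ->.
exists G, r, p, q, a, b; split=> //.
- elim=> [|c s IH]; first by rewrite cats0.
  by rewrite !ext_cons -catA IH !catA -EG.
by move=> c; have := congr1 size (EG c); rewrite !size_cat addnC => /addIn.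
Qed.

Lemma pre_catl (T : Type) (x : nat -> T) s t : s ++ t = pre x (size (s ++ t)) ->
  s = pre x (size s) /\ t = pre (shift (size s) x) (size t).
Proof.
rewrite size_cat preD => E.
by apply: (catl_inj E); rewrite size_pre.
Qed.

Lemma commuting_ext (h : 'I_2 -> seq 'I_2) s : h b0 ++ h b1 = h b1 ++ h b0 ->
  ext h s = wpow (count_mem b0 s) (h b0) ++ wpow (ones s) (h b1).
Proof.
move=> E.
have Hc n : h b1 ++ wpow n (h b0) = wpow n (h b0) ++ h b1.
  elim: n => [|n IH]; first by rewrite cats0.
  by rewrite wpowS catA -E -catA IH catA.
elim: s => //= c s IH; rewrite ext_cons IH /ones.
case: (bin_cases c) => -> /=; first by rewrite add0n add1n wpowS -catA.
by rewrite add0n add1n wpowS !catA Hc.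
Qed.

Lemma recurrent_count x (m : nat) : recurrent_letters x -> exists n, m <= count_mem b0 (pre x n).
Proof.
move=> H; elim: m => [|m [n Hn]]; first by exists 0.
have [i [Hi Ei]] := H n b0; exists i.+1.
rewrite preS count_cat /= Ei eqxx addn1 ltnS; apply: leq_trans Hn _.
by rewrite -(subnKC Hi) preD count_cat leq_addr.
Qed.

(** If h(0) and h(1) commute, images of long prefixes can be rearranged to start with any power of
    h(0), so [x] has period |h(0)|. *)
Lemma fixing_noncommuting (h : 'I_2 -> seq 'I_2) x : nonerasing h -> isimg h x x ->
  recurrent_letters x -> (forall d, x =1 shift d x -> d = 0) ->
  h b0 ++ h b1 != h b1 ++ h b0.
Proof.
move=> Hh Hx Hr Hap; apply/eqP => E.
have Hpow i : pre x (i * size (h b0)) = wpow i (h b0).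
  have [n Hn] := recurrent_count i Hr.
  have := Hx n; rewrite (commuting_ext _ E) -(subnKC Hn) wpowD -catA => /pre_catl [-> _].
  by rewrite size_wpow.
suff : size (h b0) = 0 by have := Hh b0; lia.
apply: Hap => k; set X := size (h b0).
have : pre x (k.+1 * X) = pre (shift X x) (k.+1 * X).
  have := Hpow k.+2; rewrite mulSn preD -/X wpowS -Hpow => E'.
  by case: (catl_inj E') => [|_ ->]; rewrite ?size_pre.
by move/pre_inj; apply; have := Hh b0; rewrite -/X; nia.
Qed.

Lemma shift_occ (T : Type) (u : nat -> T) j v n : occ (shift j u) v n <-> occ u v (j + n).
Proof. by apply: eq_occ => i; rewrite /shift addnA. Qed.

(** For a bispecial factor B, both 01B and 10B occur in [shift j u]. Their images end in a r h(B)
    and b r h(B), so r h(B) = G(B) r is left special. *)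
Lemma conjugate_charprefix Z u j h (G : 'I_2 -> seq 'I_2) r p q a b :
  characteristic Z u -> isimg h (shift j u) (shift j u) ->
  (forall s, ext G s ++ r = r ++ ext h s) ->
  h b0 ++ h b1 = p ++ a :: r -> h b1 ++ h b0 = q ++ b :: r -> a != b ->
  forall v, charprefix Z v -> charprefix Z (ext G v).
Proof.
move=> H Hx EG E1 E2 Hab v [N [t Ev]].
have [k Ht] := char_tail H N.
have Hocc c d p' a' : c != d -> h c ++ h d = p' ++ a' :: r ->
    exists n, occ u (a' :: r ++ ext h (bisp (wpow N Z))) n.
  move=> Hcd E; have [n [Hn Ho]] := occ_extended_bisp j Ht (char_rec H) Hcd.
  have {}Ho : occ (shift j u) ([:: c; d] ++ bisp (wpow N Z)) (n - j).
    by apply/shift_occ; rewrite subnKC.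
  have := isimg_occ Hx Ho; rewrite ext_cat ext_cons ext_seq1 E -catA => /occ_cat [_ /shift_occ].
  by move=> Ho'; eexists; exact: Ho'.
have [n Hn] := Hocc b0 b1 _ _ isT E1; have [m Hm] := Hocc b1 b0 _ _ isT E2.
have := charprefix_left_special H Hab Hn Hm; rewrite -EG Ev ext_cat -catA.
exact: charprefix_catl.
Qed.

(* With F = stdw Z and the conjugate G of h, F x = S^q x and G x = r x; comparing the
   positions of the two sides of F G x = G F x in x gives |G(x_q)| + |F r| = q + |r|. *)
Lemma no_fixing_morphism Z u j q (h : 'I_2 -> seq 'I_2) :
  characteristic Z u -> 0 < q ->
  (forall n, stdw Z (pre (shift j u) n) =
    pre (shift q (shift j u)) (size (stdw Z (pre (shift j u) n)))) ->
  isimg h (shift j u) (shift j u) -> (forall c, 1 < size (h c)) -> False.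
Proof.
move=> H Hq HF Hx Hh; set x := shift j u in HF Hx *.
have Hne : nonerasing h by move=> c; have := Hh c; lia.
have Hap d d' : shift d x =1 shift d' x -> d = d'.
  move=> E; apply/(@addnI j)/(characteristic_aperiodic H) => i.
  by have := E i; rewrite /x /shift !addnA.
have Hrx : recurrent_letters x by exact: recurrent_shift (char_rec H).
have Hnc : h b0 ++ h b1 != h b1 ++ h b0.
  by apply: fixing_noncommuting Hx Hrx _ => // d /(Hap 0 d).
have [G [r [p [p' [a [b [EG SG E1 E2 Hab]]]]]]] := conjugate_morphism Hnc.
have HG := conjugate_charprefix H Hx EG E1 E2 Hab.
have Hcom := stdw_commute H HG.
have HsG s : 2 * size s <= size (ext G s).
  elim: s => //= c s IH; rewrite ext_cons size_cat SG; have := Hh c; lia.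
set A := size (ext G (pre x q)); set B := size (stdw Z r).
have HA : 2 * q <= A by have := HsG (pre x q); rewrite size_pre.
have HB : size r <= B by apply: size_stdw_ge.
suff /Hap : shift q x =1 shift (A + B - size r) x by blia.
(* [N] is large enough for [Y] to contain index B + i; the letter there is read in two ways. *)
move=> i; pose N := B + i.+1; set Y := stdw Z (ext G (pre x N)).
have HY : N <= size Y.
  apply: leq_trans (size_stdw_ge _ _); apply: leq_trans (HsG _); rewrite size_pre; lia.
have F1 : Y ++ stdw Z r = stdw Z r ++ stdw Z (ext h (pre x N)).
  by rewrite /Y -!stdw_cat EG.
have F2 : ext G (pre x q) ++ Y ++ r =
    r ++ ext h (pre x (q + size (stdw Z (pre x N)))).
  by rewrite -EG preD -HF ext_cat /Y Hcom catA.
have nthY : nth b0 Y (B + i) = x (q + i).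
  transitivity (nth b0 (Y ++ stdw Z r) (B + i)).
    by rewrite nth_cat ifT //; blia.
  rewrite F1 nth_cat ifF; last by apply/negbTE; rewrite -leqNgt leq_addr.
  rewrite addKn Hx HF nth_pre // -Hx.
  have := congr1 size F1; rewrite !size_cat; blia.
have nthY' : nth b0 Y (B + i) = x (A + B + i - size r).
  transitivity (nth b0 (ext G (pre x q) ++ Y ++ r) (A + (B + i))).
    by rewrite nth_cat ifF ?addKn ?nth_cat ?ifT //; blia.
  rewrite F2 nth_cat ifF; last by apply/negbTE; rewrite -leqNgt; blia.
  rewrite Hx nth_pre; first by congr x; blia.
  have := congr1 size F2; rewrite !size_cat -/A; blia.
by rewrite /shift -nthY nthY'; congr x; blia.
Qed.

(** * Fixed points of primitive morphisms and substitutions *)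

Lemma mpow_ext k (f : morph k) n s : mpow f n s = ext (fun c => mpow f n [:: c]) s.
Proof.
have Hcat t t' : mpow f n (t ++ t') = mpow f n t ++ mpow f n t'.
  elim: n => //= n; rewrite /mpow /= => ->.
  by rewrite /mapply map_cat flatten_cat.
have Hnil : mpow f n [::] = [::] by elim: (n) => //= m; rewrite /mpow /= => ->.
by elim: s => //= c s IH; rewrite ext_cons -IH -Hcat.
Qed.

Lemma fixed_point_mpow k (f : morph k) x n : fixed_point f x ->
  isimg (fun c => mpow f n [:: c]) x x.
Proof.
case=> H _ m; rewrite -mpow_ext; elim: n => [|n IH]; first by rewrite size_pre.
by rewrite /mpow iterS -/(mpow f n _) IH; exact: H.
Qed.

(** In a suitable power of [f] the image of u_N contains every letter, and this image starts in [u]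
    at position N or later. *)
Lemma primitive_recurrent (f : morph 2) u : primitive f -> fixed_point f u -> recurrent_letters u.
Proof.
move=> [n [_ Hn]] /(fixed_point_mpow n) H N c.
set g := fun c => _ in H.
have Hne : nonerasing g by move=> d; have := Hn d c; rewrite /g; case: mpow.
have := H N.+1; rewrite preS ext_cat ext_seq1 => /pre_catl [_ E].
have := Hn (u N) c; rewrite -/(g (u N)) E => /(nthP b0) [i].
rewrite size_pre => Hi; rewrite nth_pre // => Ei.
exists (size (ext g (pre u N)) + i); split=> //.
by have := size_ext_ge (pre u N) Hne; rewrite size_pre; lia.
Qed.

(** The iterates of [f] on [c] are strictly increasing prefixes of one another; letter i of the
    limit is read in the i-th, which has more than i letters. *)
Lemma substitution_fixed_point k (f : morph k) : nonerasing f -> substitution f ->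
  exists u, fixed_point f u.
Proof.
move=> Hne [c [[s [Hs Ec]] _]]; pose P n := mpow f n [:: c].
have HP n : exists t, P n.+1 = P n ++ t /\ t != [::].
  exists (mpow f n s); split.
    rewrite /P /mpow iterSr -!/(mpow _ _ _) /mapply /= cats0 Ec.
    by rewrite mpow_ext ext_cons -mpow_ext.
  elim: n => //= n; rewrite /mpow /= -/(mpow f n s); case: (mpow f n s) => //= d t _.
  by rewrite /mapply /=; have := Hne d; case: (f d).
have HPle m n : m <= n -> exists t, P n = P m ++ t.
  move=> /subnKC <-; elim: (n - m) => [|d [t E]]; first by exists [::]; rewrite addn0 cats0.
  have [t' [E' _]] := HP (m + d); exists (t ++ t').
  by rewrite addnS E' E catA.
have Hsz n : n < size (P n).
  elim: n => // n IH; have [t [-> Ht]] := HP n; rewrite size_cat.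
  by case: t Ht => //= *; lia.
pose u i := nth c (P i) i.
have Hu m : P m = pre u (size (P m)).
  apply: (@eq_from_nth _ c); rewrite ?size_pre // => i Hi; rewrite nth_pre // /u.
  case: (leqP m i) => Hmi; first by have [t ->] := HPle _ _ Hmi; rewrite nth_cat Hi.
  by have [t ->] := HPle _ _ (ltnW Hmi); rewrite nth_cat Hsz.
exists u; split=> n; last by exists n; have := size_ext_ge (pre u n) Hne; rewrite size_pre.
have := Hu n.+1; rewrite /P /mpow iterS -/(mpow _ _ _) -/(P n) Hu -(subnKC (ltnW (Hsz n))) preD.
rewrite -[mapply _ _]/(ext f _) ext_cat => /pre_catl [E _]; exact: E.
Qed.

(** A power of [g] with all letters in every image fixes [x'] and has images of length at least two,
    since [x'] takes two values; it is transported back along the renaming. *)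
Lemma derived_fixing_morphism k (g : morph k) (x : nat -> 'I_2) (x' : nat -> 'I_k) :
  primitive g -> fixed_point g x' -> recurrent_letters x ->
  (forall i j, x i = x j <-> x' i = x' j) ->
  exists h : 'I_2 -> seq 'I_2, isimg h x x /\ forall c, 1 < size (h c).
Proof.
move=> [n [_ Hn]] /(fixed_point_mpow n) H Hr Hxx.
set gn := fun c => _ in H.
have [i0 [_ E0]] := Hr 0 b0; have [i1 [_ E1]] := Hr 0 b1.
have Hne : x' i0 != x' i1 by apply/eqP => /Hxx; rewrite E0 E1.
pose dec d := if d == x' i1 then b1 else b0.
pose enc (c : 'I_2) := x' (if c == b1 then i1 else i0).
have Hdec i : dec (x' i) = x i.
  rewrite /dec; case: eqP => [/Hxx ->|Hi]; first by rewrite E1.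
  by case: (bin_cases (x i)) => // E; case: Hi; apply/Hxx; rewrite E E1.
have Henc i : enc (x i) = x' i.
  by rewrite /enc; apply/Hxx; case: (bin_cases (x i)) => -> /=.
pose h c := map dec (gn (enc c)).
have Eh m : ext h (pre x m) = map dec (ext gn (pre x' m)).
  by elim: m => // m IH; rewrite !preS !ext_cat !ext_seq1 IH map_cat /h Henc.
exists h; split=> [m|c].
  by rewrite Eh size_map {1}H /pre -map_comp; apply: eq_map.
rewrite size_map; have Hu : uniq [:: x' i0; x' i1] by rewrite /= inE Hne.
apply: (uniq_leq_size Hu) => d; rewrite !inE => /orP [] /eqP ->; exact: Hn.
Qed.

(** * Derived words of fixed points of [phi_w w] *)

Lemma phi_w_nonerasing w : nonerasing (phi_w w).
Proof.
move=> c; rewrite -(ext_seq1 (phi_w w)) iphiE size_iphi.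
exact: (size_stdw_ge (map base w) [:: c]).
Qed.

Lemma mem_wpow (A : eqType) n (w : seq A) c : 0 < n -> c \in w -> c \in wpow n w.
Proof. by case: n => // n _ Hc; rewrite wpowS mem_cat Hc. Qed.

Lemma wpow_wpow (A : Type) m n (w : seq A) : wpow m (wpow n w) = wpow (m * n) w.
Proof. by elim: m => // m IH; rewrite wpowS IH mulSn wpowD. Qed.

Lemma characteristic_fixed w n u : 2 < size (undup w) -> 0 < n ->
  primitive (phi_w w) -> fixed_point (phi_w w) u ->
  characteristic (map base (wpow n w)) u.
Proof.
move=> Hw Hn Hp Hu; have H3 := three_letters Hw; split.
- have Hmem l : l \in w -> base l \in map base (wpow n w).
    by move=> Hl; apply/map_f/mem_wpow.
  apply/andP; split.
    by have /orP [] := H3 La Lb isT => /Hmem.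
  by have /orP [] := H3 Lalpha Lbeta isT => /Hmem.
- exact: primitive_recurrent Hp Hu.
move=> N; exists (size (conjw (wpow (N * n) w))).
rewrite -map_wpow wpow_wpow; apply: fix_tail; apply: iphi_fix_iter => m.
by rewrite -iphiE; exact: Hu.1.
Qed.

Lemma stdw_seq1_inj (z : seq 'I_2) c d : stdw z [:: c] = stdw z [:: d] -> c = d.
Proof.
have [t /= ->] := stdw_last z [::] c; have [t' /= ->] := stdw_last z [::] d.
by rewrite !cats1 => /rcons_inj [].
Qed.

(** Removing the first k letters of the image of [u] keeps the boundaries from index [j] on.
    Consecutive ones are separated by the image of one letter, so the derived word is
    [shift j u]. *)
Lemma bisp_derived Z u k j : characteristic Z u -> tail_of k Z u ->
  k <= size (stdw Z (pre u j)) -> (forall m, k <= size (stdw Z (pre u m)) -> j <= m) ->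
  let p := fun i => size (stdw Z (pre u (j + i))) - k in
  occ_enum u (bisp Z) p /\ forall i, return_word u p i = stdw Z [:: u (j + i)].
Proof.
move=> H Ht Hj Hmin p.
have Hp i : k + p i = size (stdw Z (pre u (j + i))).
  by rewrite /p preD stdw_cat size_cat; blia.
have HpS i : p i.+1 = p i + size (stdw Z [:: u (j + i)]).
  have := Hp i.+1; rewrite addnS preS stdw_cat size_cat -Hp; blia.
split; first split.
- by move=> i; rewrite HpS; have := size_stdw_ge Z [:: u (j + i)]; rewrite /=; blia.
- move=> n; rewrite occurs_atP (occ_tail _ _ Ht) occ_bisp; split.
    case=> m Em; have Hjm : j <= m by apply: Hmin; rewrite -Em leq_addr.
    by exists (m - j); have := Hp (m - j); rewrite subnKC // -Em; blia.
  by case=> i <-; exists (j + i); rewrite Hp.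
move=> i; rewrite /return_word HpS addKn.
have -> (m l : nat) : map u (iota m l) = pre (shift m u) l.
  by rewrite /pre -{1}[m]addn0 iotaDl -map_comp.
have := stdinfP Z u (j + i).+1; rewrite preS stdw_cat => /pre_catl [_].
rewrite -Hp => E; rewrite [RHS]E; apply: eq_pre => l.
by rewrite /shift -addnA Ht.
Qed.

Lemma both_prefix u : recurrent_letters u -> exists J, both (pre u J).
Proof.
move=> Hr; have [i0 [_ E0]] := Hr 0 b0; have [i1 [_ E1]] := Hr 0 b1.
exists (maxn i0 i1).+1; rewrite /both -{1}E0 -E1.
by apply/andP; split; apply/map_f; rewrite mem_iota; lia.
Qed.

(** Cancelling sigma in [conjwP] for the prefix of length j + n shows that [u] begins with [p]
    followed by the image of the shifted prefix. *)
Lemma run_pre w u j p : (forall n, iphi w (pre u n) = pre u (size (iphi w (pre u n)))) ->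
  run w (pre u j) p -> p = pre u (size p) /\
  forall n, stdw (map base w) (pre (shift j u) n) =
    pre (shift (size p) u) (size (stdw (map base w) (pre (shift j u) n))).
Proof.
move=> H R.
have key n : p ++ stdw (map base w) (pre (shift j u) n) ++ conjw w =
    pre u (size (p ++ stdw (map base w) (pre (shift j u) n) ++ conjw w)).
  have := conjwP w (pre u (j + n)); rewrite preD stdw_cat R -!catA -preD => E.
  by case: (catl_inj E) => // _ ->; rewrite -H.
split; first by have [] := pre_catl (key 0).
by move=> n; have [_ /pre_catl []] := pre_catl (key n).
Qed.

Theorem theorem20 (w : seq letter) :
  2 < size (undup w) -> ~ closeable (phi_w w).
Proof.
move=> Hw [M [HM [Hprim Hclosed]]].
have [Hp Hs] := Hprim _ _ HM.
have [u Hu] := substitution_fixed_point (@phi_w_nonerasing w) Hs.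
have Hr := primitive_recurrent Hp Hu.
have [J HJ] := both_prefix Hr.
(* By [run_growth] this exponent yields a [p] of length at least J + 1, while [j] is at most [J];
   hence q = |p| - j is positive. *)
pose W := wpow (J.+1 + 3) w; pose Z := map base W.
have HZ : characteristic Z u by apply: characteristic_fixed.
have Hfix n : iphi W (pre u n) = pre u (size (iphi W (pre u n))).
  by apply: iphi_fix_iter => m; rewrite -iphiE; exact: Hu.1.
have Hex : exists j, size (conjw W) <= size (stdw Z (pre u j)).
  by exists J; have [p [-> _]] := both_run W HJ; rewrite size_cat leq_addr.
case: (ex_minnP Hex) => j Hj Hmin.
have HjJ : j <= J.
  by apply: Hmin; have [p [-> _]] := both_run W HJ; rewrite size_cat leq_addr.
have [p [Ep _]] := cat_le_split (conjwP W (pre u j)) Hj.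
have [_ Hpsize] := run_growth Hw Ep.
have [_ HF] := run_pre Hfix Ep.
have [Henum Hret] := bisp_derived HZ (fix_tail Hfix) Hj Hmin.
have Hfac : factor u (bisp Z).
  by eexists; apply/(Henum.2 _); exists 0.
have [k [g [Hg [x [Hx Hxx]]]]] := Hclosed _ _ HM u Hu _ Hfac _ Henum.
have [Hgp _] := Hprim _ _ Hg.
have Hrx := recurrent_shift j Hr.
have Hderived i i' : shift j u i = shift j u i' <-> x i = x i'.
  by rewrite -Hxx !Hret /shift; split=> [->|/stdw_seq1_inj].
have [h [Hhx Hh]] := derived_fixing_morphism Hgp Hx Hrx Hderived.
apply: (no_fixing_morphism (q := size p - j) HZ _ _ Hhx Hh); first by blia.
move=> n; rewrite {1}HF; apply: eq_pre => i; rewrite /shift; congr u; blia.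
Qed.
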